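(* $(HH^\bullet(A),\cup)$ is a graded commutative associative algebra whose product is trivial except for the action of the unit: $HH^0(A)=\mathbf{k}\cdot 1$ acts by scalar multiplication, and $f\cup g=0$ for all $f\in HH^{-m}(A)$, $g\in HH^{-n}(A)$ with $m,n\ge 1$.
   Context: $\mathbf{k}$ is a field of characteristic $0$, $A=\mathbf{k}\langle x,y,z\rangle/(x^2+yx,\,xz,\,zy)$, $A^e=A\otimes A^{\mathrm{op}}$. Hochschild cohomology is placed in non-positive degrees: $HH^{-n}(A)=\mathrm{Ext}^n_{A^e}(A,A)$, and $\cup$ is the usual cup product on Hochschild cohomology. $A$ is Koszul, and $HH^{-n}(A)$ is the $n$-th cohomology of the complex $\mathrm{Hom}(V_\bullet,A)$ coming from the two-sided Koszul resolution, where $V_0=\mathbf{k}$, $V_1=\mathbf{k}\{x,y,z\}$, $V_2=\mathbf{k}\{(x+y)x,xz,zy\}$, $V_3=\mathbf{k}\{(x+y)xz,xzy\}$, $V_4=\mathbf{k}\{(x+y)xzy\}$, $V_n=0$ for $n\ge5$. On Koszul cochains $f:V_m\to A$, $g:V_n\to A$ the cup product is $(f\cup g)(a_1\cdots a_{m+n})=(-1)^{mn}f(a_1\cdots a_m)\,g(a_{m+1}\cdots a_{m+n})$ for $a_1\cdots a_{m+n}\in V_{m+n}$ (extended linearly over sums of words, with $V_{m+n}\subset V_m\otimes V_n$). *)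

(* Defs.v *)
From HB Require Import structures.
From mathcomp Require Import all_boot all_algebra.
From mathcomp Require Import generic_quotient ring_quotient.
From mathcomp Require Import boolp functions finmap.
From mathcomp.multinomials Require Import monalg.

Set Implicit Arguments.
Unset Strict Implicit.
Unset Printing Implicit Defensive.

Import GRing.Theory.
Local Open Scope ring_scope.
Local Open Scope quotient_scope.

(* ring_quotient.v provides {quot S} as a Z-module; here it is made a k-module,
   and then a k-algebra when S is a proper two-sided ideal. *)
Section QuotientModule.
Variables (k : nzRingType) (V : lmodType k) (S : submodClosed V).

(* In ssralg, submodClosed does not entail zmodClosed. *)
Definition submod_pred : {pred V} := S.

Fact submod_pred_zmod : zmod_closed submod_pred.
Proof.
split=> [|u v Su Sv]; first exact: (rpred0 S).
by apply: (rpredD (S := S)) => //; rewrite -scaleN1r; apply: (rpredZ (s := S)).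
Qed.

HB.instance Definition _ := GRing.isZmodClosed.Build V submod_pred
  submod_pred_zmod.

Definition lquot : Type := Quotient.quot submod_pred.

HB.instance Definition _ := GRing.Zmodule.on lquot.

Definition lquot_pi (v : V) : lquot := \pi_(Quotient.quot submod_pred) v.
Definition lquot_repr (q : lquot) : V := repr (q : Quotient.quot submod_pred).

Lemma lquot_reprK : cancel lquot_repr lquot_pi.
Proof. exact: reprK. Qed.

Lemma lquot_piP (u v : V) : reflect (lquot_pi u = lquot_pi v) (u - v \in S).
Proof. rewrite (Quotient.idealrBE submod_pred); exact: eqP. Qed.

Lemma lquot_piD u v : lquot_pi (u + v) = lquot_pi u + lquot_pi v.
Proof. exact: (raddfD (\pi_(Quotient.quot submod_pred))). Qed.

Lemma lquot_pi0 : lquot_pi 0 = 0.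
Proof. exact: (raddf0 (\pi_(Quotient.quot submod_pred))). Qed.

Lemma lquot_repr_pi v : lquot_repr (lquot_pi v) - v \in S.
Proof. by apply/lquot_piP; rewrite lquot_reprK. Qed.

Definition lquot_scale (c : k) (q : lquot) : lquot :=
  lquot_pi (c *: lquot_repr q).

Lemma lquot_scale_pi c v : lquot_scale c (lquot_pi v) = lquot_pi (c *: v).
Proof. by apply/lquot_piP; rewrite -scalerBr rpredZ ?lquot_repr_pi. Qed.

Fact lquot_scaleA a b q :
  lquot_scale a (lquot_scale b q) = lquot_scale (a * b) q.
Proof. by rewrite -[q]lquot_reprK !lquot_scale_pi scalerA. Qed.

Fact lquot_scale1 : left_id 1 lquot_scale.
Proof. by move=> q; rewrite -[q]lquot_reprK lquot_scale_pi scale1r. Qed.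

Fact lquot_scaleDr : right_distributive lquot_scale +%R.
Proof.
move=> c p q; rewrite -[p]lquot_reprK -[q]lquot_reprK -lquot_piD !lquot_scale_pi.
by rewrite scalerDr lquot_piD.
Qed.

Fact lquot_scaleDl q : {morph lquot_scale^~ q : a b / a + b}.
Proof.
by move=> a b /=; rewrite -[q]lquot_reprK !lquot_scale_pi scalerDl lquot_piD.
Qed.

HB.instance Definition _ := GRing.Zmodule_isLmodule.Build k lquot
  lquot_scaleA lquot_scale1 lquot_scaleDr lquot_scaleDl.

Lemma lquot_piZ c v : lquot_pi (c *: v) = c *: lquot_pi v.
Proof. by rewrite -lquot_scale_pi. Qed.

End QuotientModule.

(* Properness is needed because algType requires 1 != 0. *)
Record proper_tsideal (R : nzRingType) := ProperTsideal {
  tsideal_set :> R -> Prop;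
  tsideal0 : tsideal_set 0;
  tsidealD : forall p q, tsideal_set p -> tsideal_set q -> tsideal_set (p + q);
  tsidealMl : forall a p, tsideal_set p -> tsideal_set (a * p);
  tsidealMr : forall p b, tsideal_set p -> tsideal_set (p * b);
  tsideal1 : ~ tsideal_set 1
}.

Section QuotientAlgebra.
Variables (k : nzRingType) (R : algType k) (I : proper_tsideal R).

Definition in_tsideal : {pred R} := fun p => `[< I p >].

Fact in_tsideal_submod : submod_closed in_tsideal.
Proof.
split=> [|c p q /asboolP Ip /asboolP Iq]; apply/asboolP; first exact: tsideal0.
by apply: tsidealD => //; rewrite -mulr_algl; apply: tsidealMl.
Qed.

HB.instance Definition _ := GRing.isSubmodClosed.Build k R in_tsideal
  in_tsideal_submod.

Definition qalg : Type := lquot in_tsideal.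

HB.instance Definition _ := GRing.Lmodule.on qalg.

Definition qalg_pi : R -> qalg := @lquot_pi k R in_tsideal.

Definition qalg_mul (p q : qalg) : qalg := qalg_pi (lquot_repr p * lquot_repr q).

Lemma qalg_piP (p q : R) : qalg_pi p = qalg_pi q <-> I (p - q).
Proof.
by split=> [/lquot_piP/asboolP|Ipq] //; apply/lquot_piP/asboolP.
Qed.

Lemma qalg_mul_pi p q : qalg_mul (qalg_pi p) (qalg_pi q) = qalg_pi (p * q).
Proof.
apply/qalg_piP; set p' := lquot_repr _; set q' := lquot_repr _.
have -> : p' * q' - p * q = (p' - p) * q' + p * (q' - q).
  by rewrite mulrBl mulrBr addrA subrK.
apply: tsidealD; [apply: tsidealMr | apply: tsidealMl];
  by apply/qalg_piP; rewrite [LHS]lquot_reprK.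
Qed.

Lemma qalg_pi_surj (q : qalg) : {p | q = qalg_pi p}.
Proof. by exists (lquot_repr q); rewrite [RHS]lquot_reprK. Qed.

Fact qalg_mulA : associative qalg_mul.
Proof.
move=> x y z; case: (qalg_pi_surj x) (qalg_pi_surj y) (qalg_pi_surj z).
by move=> p -> [q ->] [r ->]; rewrite !qalg_mul_pi mulrA.
Qed.

Fact qalg_mul1 : left_id (qalg_pi 1) qalg_mul.
Proof. by move=> x; case: (qalg_pi_surj x) => p ->; rewrite qalg_mul_pi mul1r. Qed.

Fact qalg_1mul : right_id (qalg_pi 1) qalg_mul.
Proof. by move=> x; case: (qalg_pi_surj x) => p ->; rewrite qalg_mul_pi mulr1. Qed.

Lemma qalg_piD p q : qalg_pi (p + q) = qalg_pi p + qalg_pi q.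
Proof. exact: lquot_piD. Qed.

Lemma qalg_piZ c p : qalg_pi (c *: p) = c *: qalg_pi p.
Proof. exact: lquot_piZ. Qed.

Fact qalg_mulDl : left_distributive qalg_mul +%R.
Proof.
move=> x y z; case: (qalg_pi_surj x) (qalg_pi_surj y) (qalg_pi_surj z).
by move=> p -> [q ->] [r ->]; rewrite -qalg_piD !qalg_mul_pi mulrDl qalg_piD.
Qed.

Fact qalg_mulDr : right_distributive qalg_mul +%R.
Proof.
move=> x y z; case: (qalg_pi_surj x) (qalg_pi_surj y) (qalg_pi_surj z).
by move=> p -> [q ->] [r ->]; rewrite -qalg_piD !qalg_mul_pi mulrDr qalg_piD.
Qed.

Fact qalg_1neq0 : qalg_pi 1 != 0.
Proof.
apply/eqP; rewrite -[0](lquot_pi0 in_tsideal) => /qalg_piP.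
by rewrite subr0; apply: tsideal1.
Qed.

HB.instance Definition _ := GRing.Zmodule_isNzRing.Build qalg
  qalg_mulA qalg_mul1 qalg_1mul qalg_mulDl qalg_mulDr qalg_1neq0.

Lemma qalg_piM p q : qalg_pi (p * q) = qalg_pi p * qalg_pi q.
Proof. by rewrite -qalg_mul_pi. Qed.

Fact qalg_scaleAl (c : k) (x y : qalg) : c *: (x * y) = (c *: x) * y.
Proof.
case: (qalg_pi_surj x) (qalg_pi_surj y) => p -> [q ->].
by rewrite -qalg_piM -!qalg_piZ -qalg_piM scalerAl.
Qed.

HB.instance Definition _ := GRing.Lmodule_isLalgebra.Build k qalg qalg_scaleAl.

Fact qalg_scaleAr (c : k) (x y : qalg) : c *: (x * y) = x * (c *: y).
Proof.
case: (qalg_pi_surj x) (qalg_pi_surj y) => p -> [q ->].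
by rewrite -qalg_piM -!qalg_piZ -qalg_piM scalerAr.
Qed.

HB.instance Definition _ := GRing.Lalgebra_isAlgebra.Build k qalg qalg_scaleAr.

End QuotientAlgebra.

(* monalg.v declares the algebra structure only for commutative monoids. *)
Section FreeAlgebra.
Variables (k : comNzRingType) (I : choiceType).

Definition free_alg : Type := {malg k[{fmonom I}]}.

HB.instance Definition _ := GRing.Lalgebra.on free_alg.

Fact free_alg_scaleAr (c : k) (p q : free_alg) : c *: (p * q) = p * (c *: q).
Proof.
apply/malgP=> m; rewrite mcoeffZ mcoeffMl.
rewrite (mcoeffMlw _ (fsubset_refl (msupp p)) (msuppZ_le c q)) mulr_sumr.
apply: eq_bigr => m1 _; rewrite mulr_sumr; apply: eq_bigr => m2 _.
by rewrite mcoeffZ mulrCA mulrnAr.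
Qed.

HB.instance Definition _ := GRing.Lalgebra_isAlgebra.Build k free_alg
  free_alg_scaleAr.

Definition fgen (i : I) : free_alg := << fmu i >>.

(* The two-sided ideal generated by rels. *)
Inductive tsideal_gen (rels : seq free_alg) : free_alg -> Prop :=
| Tsgen r of r \in rels : tsideal_gen rels r
| Tsgen0 : tsideal_gen rels 0
| TsgenD p q of tsideal_gen rels p & tsideal_gen rels q :
    tsideal_gen rels (p + q)
| TsgenMl a p of tsideal_gen rels p : tsideal_gen rels (a * p)
| TsgenMr p b of tsideal_gen rels p : tsideal_gen rels (p * b).

Definition const_coeff (p : free_alg) : k :=
  mcoeff mone (p : {malg k[{fmonom I}]}).

Lemma tsideal_gen_proper (rels : seq free_alg) :
  {in rels, forall r, const_coeff r = 0} -> ~ tsideal_gen rels 1.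
Proof.
move=> rels0 I1; suff: const_coeff 1 = 0.
  by rewrite /const_coeff mcoeff1 eqxx => /eqP; rewrite oner_eq0.
elim: I1 => [r /rels0||p q _ p0 _ q0|a p _ p0|p b _ p0] //.
- exact: mcoeff0.
- by rewrite /const_coeff mcoeffD [X in X + _]p0 [X in _ + X]q0 addr0.
- by rewrite /const_coeff (rmorphM (mcoeff mone)) [X in _ * X]p0 mulr0.
- by rewrite /const_coeff (rmorphM (mcoeff mone)) [X in X * _]p0 mul0r.
Qed.

Definition presented_ideal (rels : seq free_alg)
    (rels0 : {in rels, forall r, const_coeff r = 0}) :
    proper_tsideal free_alg :=
  @ProperTsideal free_alg (tsideal_gen rels) (Tsgen0 rels)
    (@TsgenD rels) (@TsgenMl rels) (@TsgenMr rels) (tsideal_gen_proper rels0).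

End FreeAlgebra.

Section AlgebraA.
Variable k : fieldType.

Definition gx : free_alg k 'I_3 := fgen k (inord 0).
Definition gy : free_alg k 'I_3 := fgen k (inord 1).
Definition gz : free_alg k 'I_3 := fgen k (inord 2).

Definition relsA : seq (free_alg k 'I_3) :=
  [:: gx ^+ 2 + gy * gx; gx * gz; gz * gy].

Fact const_coeff_relsA : {in relsA, forall r, const_coeff r = 0}.
Proof.
have g0 i : const_coeff (fgen k i : free_alg k 'I_3) = 0.
  rewrite /const_coeff mcoeffU1; case: eqP => // /(congr1 (@fmonom_val _)).
  by rewrite fm1 fmuE.
have M0 i (q : free_alg k 'I_3) : const_coeff (fgen k i * q) = 0.
  by rewrite /const_coeff (rmorphM (mcoeff mone)) [X in X * _]g0 mul0r.
move=> r; rewrite !inE => /or3P[] /eqP->; try exact: M0.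
by rewrite /const_coeff mcoeffD [X in X + _]M0 [X in _ + X]M0 addr0.
Qed.

Definition algA : Type := qalg (presented_ideal const_coeff_relsA).

HB.instance Definition _ := GRing.Algebra.on algA.

End AlgebraA.

(* Hochschild cohomology of A with coefficients in A, computed by the bar
   complex: the bar resolution consists of the free A^e-modules
   A (x) A^{(x) n} (x) A, and A^e-linear maps from it to A are the n-linear maps
   A^n -> A; so HH n is Ext^n_{A^e}(A, A). It is indexed by n >= 0 but sits in
   degree -n, which changes neither the grading of products nor Koszul signs. *)
Section Hochschild.
Variables (k : fieldType) (A : algType k).

Definition multilinear n (f : ('I_n -> A) -> A) : Prop :=
  forall (a : 'I_n -> A) (i : 'I_n) (c : k) (u v : A),
    f [eta a with i |-> c *: u + v] =
      c *: f [eta a with i |-> u] + f [eta a with i |-> v].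

(* (a_0, .., a_n) |-> (a_0, .., a_i a_{i+1}, .., a_n) *)
Definition contract n (i : 'I_n) (a : 'I_n.+1 -> A) : 'I_n -> A := fun j =>
  if (j < i)%N then a (widen_ord (leqnSn n) j)
  else if j == i then a (widen_ord (leqnSn n) j) * a (lift ord0 j)
  else a (lift ord0 j).

Definition hdiff n (f : ('I_n -> A) -> A) : ('I_n.+1 -> A) -> A := fun a =>
  a ord0 * f (fun j => a (lift ord0 j))
  + \sum_(i < n) (-1) ^+ i.+1 * f (contract i a)
  + (-1) ^+ n.+1 * (f (fun j => a (widen_ord (leqnSn n) j)) * a ord_max).

Definition is_cocycle n (f : ('I_n -> A) -> A) : Prop :=
  multilinear f /\ hdiff f = 0.

Definition is_coboundary n : (('I_n -> A) -> A) -> Prop :=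
  match n with
  | 0 => fun f => f = 0
  | m.+1 => fun f => exists2 g : ('I_m -> A) -> A, multilinear g & f = hdiff g
  end.

Lemma cochain_combE n (c : k) (f g : ('I_n -> A) -> A) :
  c *: f + g = (fun a => c *: f a + g a).
Proof. by []. Qed.

Lemma hdiff_linear n (c : k) (f g : ('I_n -> A) -> A) :
  hdiff (c *: f + g) = c *: hdiff f + hdiff g.
Proof.
rewrite !cochain_combE; apply/funext => a; rewrite /hdiff.
under eq_bigr do rewrite mulrDr -scalerAr.
rewrite big_split -scaler_sumr /= !mulrDr mulrDl mulrDr -scalerAl -!scalerAr.
rewrite !scalerDr -!addrA; congr (_ + _); rewrite addrCA; congr (_ + _).
by rewrite [RHS]addrCA; congr (_ + _); apply: addrCA.
Qed.

Lemma hdiff0 n : hdiff (0 : ('I_n -> A) -> A) = 0.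
Proof.
have := @hdiff_linear n 1 0 0; rewrite !scale1r addr0 => h.
by apply: (addrI (hdiff 0)); rewrite addr0 -h.
Qed.

Lemma multilinear0 n : multilinear (0 : ('I_n -> A) -> A).
Proof. by move=> a i c u v; rewrite [LHS]/= scaler0 addr0. Qed.

Lemma multilinear_comb n (c : k) (f g : ('I_n -> A) -> A) :
  multilinear f -> multilinear g -> multilinear (c *: f + g).
Proof.
move=> mf mg a i b u v; rewrite cochain_combE mf mg !scalerDr !scalerA.
by rewrite [b * c]mulrC -!addrA; congr (_ + _); rewrite addrCA.
Qed.

Definition in_cocycle n : {pred ('I_n -> A) -> A} := fun f => `[< is_cocycle f >].

Fact in_cocycle_submod n : submod_closed (@in_cocycle n).
Proof.
split=> [|c f g /asboolP[mf df] /asboolP[mg dg]]; apply/asboolP; split.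
- exact: multilinear0.
- exact: hdiff0.
- exact: multilinear_comb.
- by rewrite hdiff_linear df dg scaler0 addr0.
Qed.

HB.instance Definition _ n :=
  GRing.isSubmodClosed.Build k (('I_n -> A) -> A) (@in_cocycle n)
    (@in_cocycle_submod n).

Record cocycle n := Cocycle {
  cocycle_fun :> ('I_n -> A) -> A;
  _ : cocycle_fun \in @in_cocycle n
}.

HB.instance Definition _ n := [isSub for @cocycle_fun n].
HB.instance Definition _ n := [Choice of cocycle n by <:].
HB.instance Definition _ n := [SubChoice_isSubLmodule of cocycle n by <:].

Lemma cocycleP n (f : cocycle n) : is_cocycle f.
Proof. by have /asboolP := valP f. Qed.

Definition mk_cocycle n (f : ('I_n -> A) -> A) (fP : is_cocycle f) : cocycle n :=
  Cocycle (asboolT fP : f \in @in_cocycle n).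

Definition in_coboundary n : {pred cocycle n} := fun f => `[< is_coboundary f >].

Lemma coboundary0 n : is_coboundary (0 : ('I_n -> A) -> A).
Proof.
case: n => [//|n]; exists 0; first exact: multilinear0.
by rewrite hdiff0.
Qed.

Lemma coboundary_comb n (c : k) (f g : ('I_n -> A) -> A) :
  is_coboundary f -> is_coboundary g -> is_coboundary (c *: f + g).
Proof.
case: n f g => [|n] f g /=; first by move=> -> ->; rewrite scaler0 addr0.
move=> [f' mf' ->] [g' mg' ->]; exists (c *: f' + g').
  exact: multilinear_comb.
by rewrite hdiff_linear.
Qed.

Fact in_coboundary_submod n : submod_closed (@in_coboundary n).
Proof.
split=> [|c f g /asboolP bf /asboolP bg]; apply/asboolP.
  exact: coboundary0.
exact: coboundary_comb.
Qed.

HB.instance Definition _ n :=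
  GRing.isSubmodClosed.Build k (cocycle n) (@in_coboundary n)
    (@in_coboundary_submod n).

Definition HH n : Type := lquot (@in_coboundary n).

HB.instance Definition _ n := GRing.Lmodule.on (HH n).

Definition hclass n : cocycle n -> HH n := @lquot_pi k _ (@in_coboundary n).

Lemma hclassP n (f g : cocycle n) :
  hclass f = hclass g <-> is_coboundary (cocycle_fun f - cocycle_fun g).
Proof.
by split=> [/lquot_piP/asboolP|bfg] //; apply/lquot_piP/asboolP.
Qed.

Lemma hclass_surj n (u : HH n) : {f | u = hclass f}.
Proof. by exists (lquot_repr u); rewrite [RHS]lquot_reprK. Qed.

Definition cochain_cup m n (f : ('I_m -> A) -> A) (g : ('I_n -> A) -> A) :
    ('I_(m + n) -> A) -> A :=
  fun a => (-1) ^+ (m * n) *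
    (f (fun i => a (lshift n i)) * g (fun j => a (rshift m j))).

Lemma cochain_cup_multilinear m n (f : ('I_m -> A) -> A) (g : ('I_n -> A) -> A) :
  multilinear f -> multilinear g -> multilinear (cochain_cup f g).
Proof.
move=> mf mg a i c u v; rewrite /cochain_cup.
have ll (i' : 'I_m) w : (fun j => [eta a with lshift n i' |-> w] (lshift n j)) =
    [eta (fun j => a (lshift n j)) with i' |-> w].
  by apply/funext => j /=; rewrite (inj_eq (@lshift_inj _ _)).
have lr (i' : 'I_m) w : (fun j => [eta a with lshift n i' |-> w] (rshift m j)) =
    (fun j => a (rshift m j)).
  by apply/funext => j /=; rewrite eq_rlshift.
have rl (i' : 'I_n) w : (fun j => [eta a with rshift m i' |-> w] (lshift n j)) =
    (fun j => a (lshift n j)).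
  by apply/funext => j /=; rewrite eq_lrshift.
have rr (i' : 'I_n) w : (fun j => [eta a with rshift m i' |-> w] (rshift m j)) =
    [eta (fun j => a (rshift m j)) with i' |-> w].
  by apply/funext => j /=; rewrite (inj_eq (@rshift_inj _ _)).
case: (split_ordP i) => i' ->.
  by rewrite !ll !lr mf mulrDl mulrDr -scalerAl -scalerAr.
by rewrite !rl !rr mg !mulrDr -!scalerAr.
Qed.

Lemma cochain_cup_leibniz m n (f : ('I_m -> A) -> A) (g : ('I_n -> A) -> A)
    (a : 'I_(m + n).+1 -> A) :
  let aL : 'I_m.+1 -> A := fun i => a (lshift n i : 'I_(m.+1 + n)) in
  let aR : 'I_n.+1 -> A := fun j => a (cast_ord (addnS m n) (rshift m j)) in
  hdiff (cochain_cup f g) a =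
    (-1) ^+ (m * n) *
     (hdiff f aL * g (fun j => aR (lift ord0 j)) +
      (-1) ^+ m * (f (fun i => aL (widen_ord (leqnSn m) i)) * hdiff g aR)).
Proof.
move=> aL aR.
have sZ (p : nat) (x : A) : (-1) ^+ p * x = ((-1) ^+ p : k) *: x.
  rewrite -signr_odd -[X in _ = X *: _]signr_odd; case: (odd p).
    by rewrite mulN1r scaleN1r.
  by rewrite mul1r scale1r.
have a_eq (i j : 'I_(m + n).+1) : i = j :> nat -> a i = a j.
  by move=> /val_inj ->.
have eL0 : a ord0 = aL ord0 by apply: a_eq.
have eLm : aL ord_max = aR ord0 by apply: a_eq; rewrite /= addn0.
have eRm : a ord_max = aR ord_max by apply: a_eq.
have e0l : (fun i : 'I_m => a (lift ord0 (lshift n i))) =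
    (fun i => aL (lift ord0 i)).
  by apply/funext => i; apply: a_eq.
have e0r : (fun j : 'I_n => a (lift ord0 (rshift m j))) =
    (fun j => aR (lift ord0 j)).
  by apply/funext => j; apply: a_eq; rewrite /= /bump /= !add1n addnS.
have ewl : (fun i : 'I_m => a (widen_ord (leqnSn _) (lshift n i))) =
    (fun i => aL (widen_ord (leqnSn m) i)).
  by apply/funext => i; apply: a_eq.
have ewr : (fun j : 'I_n => a (widen_ord (leqnSn _) (rshift m j))) =
    (fun j => aR (widen_ord (leqnSn n) j)).
  by apply/funext => j; apply: a_eq.
have cll i : (fun j : 'I_m => contract (lshift n i) a (lshift n j)) =
    contract i aL.
  apply/funext => j; rewrite /contract /= (inj_eq (@lshift_inj _ _)).
  by case: ifP => _; [|case: ifP => _; [congr (_ * _)|]]; apply: a_eq.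
have clr i : (fun j : 'I_n => contract (lshift n i) a (rshift m j)) =
    (fun j => aR (lift ord0 j)).
  apply/funext => j; rewrite /contract /= eq_rlshift ltnNge ltnW /=; last first.
    by rewrite (leq_trans (ltn_ord i)) ?leq_addr.
  by apply: a_eq; rewrite /= /bump /= !add1n addnS.
have crl i : (fun j : 'I_m => contract (rshift m i) a (lshift n j)) =
    (fun j => aL (widen_ord (leqnSn m) j)).
  apply/funext => j; rewrite /contract /= ifT; first exact: a_eq.
  by rewrite (leq_trans (ltn_ord j)) ?leq_addr.
have crr i : (fun j : 'I_n => contract (rshift m i) a (rshift m j)) =
    contract i aR.
  apply/funext => j; rewrite /contract /= (inj_eq (@rshift_inj _ _)) ltn_add2l.
  case: ifP => _; [|case: ifP => _; [congr (_ * _)|]]; apply: a_eq => //=;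
  by rewrite /bump /= !add1n addnS.
rewrite /hdiff /cochain_cup big_split_ord /= eL0 eRm e0l e0r ewl ewr.
under eq_bigr do rewrite cll clr !sZ.
under [X in _ + (_ + X) + _]eq_bigr do rewrite crl crr !sZ.
under [X in _ = _ * ((_ + X + _) * _ + _)]eq_bigr do rewrite sZ.
under [X in _ = _ * (_ + _ * (_ * (_ + X + _)))]eq_bigr do rewrite sZ.
rewrite !sZ eLm {sZ a_eq eL0 eLm eRm e0l e0r ewl ewr cll clr crl crr}.
set s : k := (-1) ^+ (m * n); set g0 := g (fun _ => aR (lift _ _)).
set fw := f (fun _ => aL (widen_ord _ _)).
set gw := g (fun _ => aR (widen_ord _ _)).
have -> : \sum_(i < m) (-1) ^+ i.+1 *: (s *: (f (contract i aL) * g0)) =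
    s *: (\sum_(i < m) (-1) ^+ i.+1 *: f (contract i aL) * g0).
  rewrite scaler_sumr; apply: eq_bigr => i _.
  by rewrite -scalerAl !scalerA mulrC.
have -> : \sum_(j < n) (-1) ^+ (m + j).+1 *: (s *: (fw * g (contract j aR))) =
    s *: ((-1) ^+ m *: (\sum_(j < n) fw * ((-1) ^+ j.+1 *: g (contract j aR)))).
  rewrite !scaler_sumr; apply: eq_bigr => j _.
  by rewrite -scalerAr !scalerA -addnS exprD [_ * s]mulrC !mulrA.
rewrite !mulrDl !mulrDr -mulr_suml -mulr_sumr.
rewrite -[in LHS]scalerAr -[in LHS](scalerAl s) [_ *: (s *: _)]scalerA.
rewrite [_ * s]mulrC -scalerA -!scalerDr; congr (s *: _).
rewrite -[in RHS]scalerAl -[in RHS]scalerAr !scalerDr !scalerA -!addrA.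
rewrite -addnS exprD mulrA mulrA; congr (_ + (_ + _)).
by rewrite [X in X *: _ + (_ + _)]exprS mulN1r scaleNr [fw * (gw * _)]mulrA addKr.
Qed.

Lemma cup_cocycle m n (f : cocycle m) (g : cocycle n) :
  is_cocycle (cochain_cup f g).
Proof.
have [mf df] := cocycleP f; have [mg dg] := cocycleP g.
split; first exact: cochain_cup_multilinear.
by apply/funext => a; rewrite cochain_cup_leibniz df dg /= mul0r !mulr0 addr0 mulr0.
Qed.

Definition cocycle_cup m n (f : cocycle m) (g : cocycle n) : cocycle (m + n) :=
  mk_cocycle (cup_cocycle f g).

Definition hcup m n (u : HH m) (v : HH n) : HH (m + n) :=
  hclass (cocycle_cup (lquot_repr u) (lquot_repr v)).

Lemma coboundary_cast p q (e : p = q) (f : ('I_p -> A) -> A) :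
  is_coboundary f ->
  is_coboundary (fun a : 'I_q -> A => f (fun i => a (cast_ord e i))).
Proof.
case: q / e => bf; congr is_coboundary: bf; apply/funext => a; congr (f _).
by apply/funext => i; rewrite cast_ord_id.
Qed.

Lemma cochain_cup_combl m n c (f f' : ('I_m -> A) -> A) (g : ('I_n -> A) -> A) :
  cochain_cup (c *: f + f') g = c *: cochain_cup f g + cochain_cup f' g.
Proof.
rewrite !cochain_combE; apply/funext => a; rewrite /cochain_cup.
by rewrite mulrDl mulrDr -scalerAl -scalerAr.
Qed.

Lemma cochain_cup_combr m n c (f : ('I_m -> A) -> A) (g g' : ('I_n -> A) -> A) :
  cochain_cup f (c *: g + g') = c *: cochain_cup f g + cochain_cup f g'.
Proof.
rewrite !cochain_combE; apply/funext => a; rewrite /cochain_cup.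
by rewrite !mulrDr -!scalerAr.
Qed.

Lemma cup_coboundaryl m n (f : ('I_m -> A) -> A) (g : ('I_n -> A) -> A) :
  is_coboundary f -> is_cocycle g -> is_coboundary (cochain_cup f g).
Proof.
case: m f => [|m] f /=.
  move=> -> _; suff -> : cochain_cup (0 : ('I_0 -> A) -> A) g = 0.
    exact: coboundary0.
  by apply/funext => a; rewrite /cochain_cup mul0r mulr0.
move=> [h mh ->] [mg dg]; exists ((-1) ^+ n *: cochain_cup h g + 0).
  apply: multilinear_comb; last exact: multilinear0.
  exact: cochain_cup_multilinear.
rewrite hdiff_linear hdiff0 addr0; apply/funext => a.
transitivity ((-1) ^+ n *: hdiff (cochain_cup h g) a); last by [].
rewrite cochain_cup_leibniz dg /= !mulr0 addr0 /cochain_cup mulSn exprD -mulrA.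
rewrite -signr_odd -[X in X *: _]signr_odd.
have -> : (fun j : 'I_n => a (rshift m.+1 j)) =
    (fun j => a (cast_ord (addnS m n) (rshift m (lift ord0 j)))).
  by apply/funext => j; congr a; apply: val_inj; rewrite /= /bump /= !add1n addnS.
by case: (odd n); rewrite ?mulN1r ?scaleN1r ?mul1r ?scale1r.
Qed.

Lemma cup_coboundaryr m n (f : ('I_m -> A) -> A) (g : ('I_n -> A) -> A) :
  is_cocycle f -> is_coboundary g -> is_coboundary (cochain_cup f g).
Proof.
case: n g => [|n] g /=.
  move=> _ ->; suff -> : cochain_cup f (0 : ('I_0 -> A) -> A) = 0.
    exact: coboundary0.
  by apply/funext => a; rewrite /cochain_cup !mulr0.
move=> [mf df] [h mh ->].
have := @coboundary_cast _ _ (esym (addnS m n)) (hdiff (cochain_cup f h)).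
set F := (fun a => _); suff -> : F = cochain_cup f (hdiff h).
  by apply; exists (cochain_cup f h); first exact: cochain_cup_multilinear.
apply/funext => a; rewrite /F cochain_cup_leibniz df /= mul0r add0r.
rewrite /cochain_cup mulnS [X in (-1) ^+ X * (f _ * hdiff h (fun j => a (rshift m j)))]addnC.
rewrite exprD -mulrA; congr (_ * (_ * (f _ * hdiff h _)));
by apply/funext => j; congr a; apply: val_inj.
Qed.

Lemma hcup_class m n (f : cocycle m) (g : cocycle n) :
  hcup (hclass f) (hclass g) = hclass (cocycle_cup f g).
Proof.
rewrite /hcup; set f' := lquot_repr _; set g' := lquot_repr _.
have bf : is_coboundary (1 *: cocycle_fun f' + - cocycle_fun f).
  by rewrite scale1r; apply/hclassP; apply: lquot_reprK.
have bg : is_coboundary (1 *: cocycle_fun g' + - cocycle_fun g).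
  by rewrite scale1r; apply/hclassP; apply: lquot_reprK.
apply/hclassP => /=.
have -> : cochain_cup f' g' - cochain_cup f g =
    1 *: cochain_cup (1 *: cocycle_fun f' + - cocycle_fun f) g' +
    cochain_cup f (1 *: cocycle_fun g' + - cocycle_fun g).
  rewrite cochain_cup_combl cochain_cup_combr !scale1r.
  have -> : cochain_cup (- cocycle_fun f) g' = - cochain_cup f g'.
    by apply/funext => a; rewrite /cochain_cup mulNr mulrN.
  have -> : cochain_cup f (- cocycle_fun g) = - cochain_cup f g.
    by apply/funext => a; rewrite /cochain_cup !mulrN.
  by rewrite addrA subrK.
apply: coboundary_comb.
  by apply: cup_coboundaryl => //; apply: cocycleP.
by apply: cup_coboundaryr => //; apply: cocycleP.
Qed.

Fact hunit_cocycle : is_cocycle (fun _ : 'I_0 -> A => 1).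
Proof.
split; first by move=> a [].
apply/funext => a; rewrite /hdiff big_ord0 mulr1 mul1r addr0 expr1 mulN1r.
by rewrite (_ : ord_max = ord0) ?subrr //; apply: val_inj.
Qed.

Definition hunit : HH 0 := hclass (mk_cocycle hunit_cocycle).

End Hochschild.

Definition gcast (k : fieldType) (H : nat -> lmodType k) m n (e : m = n)
    (u : H m) : H n := ecast i (H i) e u.

(* (H, mul, one) is an associative unital graded k-algebra that is graded
   commutative; gcast identifies components whose degrees are provably equal. *)
Record graded_commutative_algebra (k : fieldType) (H : nat -> lmodType k)
    (one : H 0) (mul : forall m n, H m -> H n -> H (m + n)%N) : Prop := {
  gca_linearl : forall m n (v : H n), linear (fun u : H m => mul m n u v);
  gca_linearr : forall m n (u : H m), linear (mul m n u);
  gca_mulA : forall m n p (u : H m) (v : H n) (w : H p),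
    gcast (addnA m n p) (mul _ _ u (mul _ _ v w)) = mul _ _ (mul _ _ u v) w;
  gca_mul1l : forall n (u : H n), gcast (add0n n) (mul _ _ one u) = u;
  gca_mul1r : forall n (u : H n), gcast (addn0 n) (mul _ _ u one) = u;
  gca_mulC : forall m n (u : H m) (v : H n),
    mul _ _ u v = (-1) ^+ (m * n) *: gcast (addnC n m) (mul _ _ v u)
}.

(* Main.v *)
Require Import Defs.
From HB Require Import structures.
From mathcomp Require Import all_boot all_algebra.
From mathcomp Require Import boolp functions finmap.
From mathcomp.multinomials Require Import monalg.
Import GRing.Theory.
Local Open Scope ring_scope.

Set Implicit Arguments.
Unset Strict Implicit.
Unset Printing Implicit Defensive.

(* Put w = x + y, so that the relations of A are wx = xz = zy = 0 with y = w - x.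
   A bar cochain of degree i + n is an i-cochain with values in the bimodule of
   n-cochains, whose right action is twisted. In this form a 2-cocycle with values
   in any such bimodule is a coboundary as soon as its restriction to the Koszul
   relations is one. The right ideals wA, xA, zA, yA are isomorphic to A/xA, A/zA,
   A/yA, A, so a linear map can be prescribed on xA, zA and yA as soon as it is
   compatible with the next relation, and the Koszul equations can be solved one
   letter at a time. This gives HH^n = 0 for n >= 5; HH^3 = 0, because
   w h2 + h1 y = 0 forces h1 in wA + Az; and it shows that a 4-cocycle vanishing
   on (w, x, -, -) is a coboundary. Hence only the bidegrees (1,1) and (2,2) matter.
   A 2-cocycle can be changed by a coboundary so that f(w, x) = 0, which settles
   (2,2). A derivation D can be changed by an inner one so that D x lies in both
   xA and Ax, and D z in z(k + Aw + Az); then D w lies in Aw, and the only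
   possibly nonzero Koszul value of a cup product of two such derivations, the one
   on zy, lies in zAw and is the coboundary of a 1-cochain supported on y. *)

(** * Actions of a free algebra on a vector space, from the left or from the right *)

Section FreeAlgebraAction.
Local Open Scope fset_scope.
Local Open Scope ring_scope.
Variables (k : fieldType) (I : choiceType) (left : bool).

(** The flag lets one development serve both sides: with [left] false this is the product of the
    opposite ring, over which a right module is a left module. *)
Definition mul_at (R : nzRingType) (a b : R) : R := if left then a * b else b * a.

Lemma mul_atA (R : nzRingType) (a b c : R) :
  mul_at (mul_at a b) c = mul_at a (mul_at b c).
Proof. by rewrite /mul_at; case: left; rewrite mulrA. Qed.

Lemma mul_at_linear (R : algType k) (a : R) : linear (mul_at a).
Proof.
move=> c u v; rewrite /mul_at; case: left.
  by rewrite mulrDr -scalerAr.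
by rewrite mulrDl -scalerAl.
Qed.

(** The head of [s] is the letter on the acting side, hence the reversal for right actions;
    [word_atE] then has one form for both sides. *)
Definition word_at (s : seq I) : free_alg k I :=
  << FMonom (if left then s else rev s) >>.

Lemma word_atE i s : word_at (i :: s) = mul_at (fgen k i) (word_at s).
Proof.
rewrite /word_at /mul_at /fgen; case: left; rewrite [RHS]fgmulUU mulr1.
  by rewrite fmuE; congr << _ >>; rewrite [RHS]fmmulE.
by rewrite fmuE; congr << _ >>; rewrite [RHS]fmmulE /= rev_cons cats1.
Qed.

Lemma word_at_nil : word_at [::] = 1.
Proof. by rewrite /word_at; case: left => /=; congr << _ >>; rewrite -[LHS]fmoneE. Qed.

Lemma monomE c (s : {fmonom I}) :
  << c *g s >> = c *: word_at (if left then s : seq I else rev s).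
Proof.
rewrite /word_at; apply/malgP => t; rewrite mcoeffZ !mcoeffU mulrnAr mulr1.
by case: s => s /=; case: left; rewrite ?revK.
Qed.

Lemma free_alg_span (P : free_alg k I -> Prop) :
  P 1 -> (forall c p q, P p -> P q -> P (c *: p + q)) ->
  (forall i p, P p -> P (mul_at (fgen k i) p)) -> forall p, P p.
Proof.
move=> P1 PD PM.
have P0 : P 0 by rewrite -(subrr 1) addrC -scaleN1r; apply: PD.
have Pw s : P (word_at s).
  elim: s => [|i s IH]; last by rewrite word_atE; apply: PM.
  by rewrite word_at_nil.
move=> p; rewrite [p]monalgE; elim/big_rec: _ => // s q _ Pq.
by rewrite monomE; apply: PD.
Qed.

Variables (M : lmodType k) (op : I -> {linear M -> M}).

Definition word_act (s : seq I) (m : M) : M :=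
  foldr (fun i => op i) m (if left then s else rev s).

Definition free_act (p : free_alg k I) (m : M) : M :=
  \sum_(s <- msupp p) p@_s *: word_act s m.

Lemma free_actEw (d : {fset {fmonom I}}) p m : msupp p `<=` d ->
  free_act p m = \sum_(s <- d) p@_s *: word_act s m.
Proof.
move=> le; rewrite /free_act; apply/big_fset_incl => // s _ /mcoeff_outdom ->.
by rewrite scale0r.
Qed.

Lemma free_actD m c p q :
  free_act (c *: p + q) m = c *: free_act p m + free_act q m.
Proof.
have le1 := fsubsetUl (msupp p) (msupp q).
have le2 := fsubsetUr (msupp p) (msupp q).
rewrite !(free_actEw (d := msupp p `|` msupp q)) //; last first.
  apply: fsubset_trans (msuppD_le _ _) _; apply: fsetSU; exact: msuppZ_le.
rewrite scaler_sumr -big_split; apply: eq_bigr => s _ /=.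
by rewrite mcoeffD mcoeffZ scalerDl scalerA.
Qed.

Lemma free_act0 m : free_act 0 m = 0.
Proof. by rewrite /free_act msupp0 big_seq_fset0. Qed.

Lemma free_act_word s m : free_act (word_at s) m = foldr (fun i => op i) m s.
Proof.
rewrite /free_act /word_at msuppU1 big_seq_fset1 mcoeffUU scale1r /word_act /=.
by case: left; rewrite ?revK.
Qed.

Lemma free_act1 m : free_act 1 m = m.
Proof. by rewrite -word_at_nil free_act_word. Qed.

Lemma free_act_gen i q m : free_act (mul_at (fgen k i) q) m = op i (free_act q m).
Proof.
have h0 : op i 0 = 0 by rewrite linear0.
rewrite [q]monalgE; elim/big_rec: _ => [|s p _ IH].
  by rewrite /mul_at mul0r mulr0 if_same free_act0 h0.
by rewrite monomE mul_at_linear !free_actD linearP IH -word_atE !free_act_word.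
Qed.

(** Both sides obey the same recursion on the letters of [p]. *)
Lemma free_act_mul p q m : free_act (mul_at p q) m = free_act p (free_act q m).
Proof.
elim/free_alg_span: p => [|c p p' IH IH'|i p IH].
- by rewrite /mul_at mul1r mulr1 if_same free_act1.
- rewrite free_actD -IH -IH' -free_actD; congr free_act.
  rewrite /mul_at; case: left; first by rewrite mulrDl -scalerAl.
  by rewrite mulrDr -scalerAr.
- by rewrite mul_atA !free_act_gen IH.
Qed.

End FreeAlgebraAction.

(** * The letters of A, its relations and the universal property of its presentation *)

Definition piA (k : fieldType) : free_alg k 'I_3 -> algA k :=
  @qalg_pi k _ (presented_ideal (@const_coeff_relsA k)).

HB.lock Definition genx (k : fieldType) : algA k := piA (gx k).
HB.lock Definition geny (k : fieldType) : algA k := piA (gy k).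
HB.lock Definition genz (k : fieldType) : algA k := piA (gz k).
HB.lock Definition genw (k : fieldType) : algA k := genx k + geny k.

Section Generators.
Variable k : fieldType.
Local Notation x := (genx k).
Local Notation y := (geny k).
Local Notation z := (genz k).
Local Notation w := (genw k).
Local Notation piA := (@piA k).

Lemma piAM p q : piA (p * q) = piA p * piA q.
Proof. exact: qalg_piM. Qed.

Lemma piAD c p q : piA (c *: p + q) = c *: piA p + piA q.
Proof. by rewrite /piA qalg_piD qalg_piZ. Qed.

Lemma relA r : r \in relsA k -> piA r = 0.
Proof.
move=> rr; rewrite -[RHS](scale0r (piA 0)) -[RHS]qalg_piZ scale0r.
by apply/qalg_piP; rewrite subr0; apply: Tsgen.
Qed.

Lemma gen_wx : w * x = 0.
Proof.
rewrite genw.unlock mulrDl genx.unlock geny.unlock -!piAM -[RHS](@relA (gx k ^+ 2 + gy k * gx k)) ?mem_head //.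
by rewrite /piA qalg_piD.
Qed.

Lemma gen_xz : x * z = 0.
Proof. by rewrite genx.unlock genz.unlock -piAM; apply: relA; rewrite mem_behead // mem_head. Qed.

Lemma gen_zy : z * y = 0.
Proof. by rewrite genz.unlock geny.unlock -piAM; apply: relA; rewrite 2?mem_behead //= mem_head. Qed.

Lemma gen_yE : y = w - x.
Proof. by rewrite genw.unlock addrC addKr. Qed.

Variable left : bool.

Lemma algA_span_at (P : algA k -> Prop) :
  P 1 -> (forall c a b, P a -> P b -> P (c *: a + b)) ->
  (forall a, P a -> [/\ P (mul_at left x a), P (mul_at left y a)
                      & P (mul_at left z a)]) ->
  forall a, P a.
Proof.
move=> P1 PD PM a; have [p ->] := qalg_pi_surj a; rewrite -[qalg_pi _ _]/(piA p).
elim/(@free_alg_span k 'I_3 left): p => [|c p q Pp Pq|i p Pp] //.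
  by rewrite piAD; apply: PD.
have -> : piA (mul_at left (fgen k i) p) = mul_at left (piA (fgen k i)) (piA p).
  by rewrite /mul_at; case: left; rewrite piAM.
have [] := PM _ Pp; rewrite genx.unlock geny.unlock genz.unlock => Px Py Pz.
have : i \in [:: inord 0; inord 1; inord 2 : 'I_3].
  by rewrite !inE -!val_eqE /= !inordK //; case: i => [[|[|[]]]].
by rewrite !inE => /or3P[] /eqP ->; [exact: Px|exact: Py|exact: Pz].
Qed.

Variables (M : lmodType k) (X Y Z : {linear M -> M}).

Let comp (f g : M -> M) m := if left then f (g m) else g (f m).

Hypothesis XX : forall m, X (X m) + comp Y X m = 0.
Hypothesis XZ : forall m, comp X Z m = 0.
Hypothesis ZY : forall m, comp Z Y m = 0.

(** The free algebra acts on M through X, Y, Z. By hypothesis the three relations, hence the whole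
    ideal, act as zero, so the action descends to A; [h] is its orbit map at [m0]. *)
Lemma algA_rec_at (m0 : M) : exists h : {linear algA k -> M}, h 1 = m0 /\
  forall a, [/\ h (mul_at left x a) = X (h a), h (mul_at left y a) = Y (h a)
              & h (mul_at left z a) = Z (h a)].
Proof.
pose op (i : 'I_3) := if i == inord 0 then X else if i == inord 1 then Y else Z.
pose act := free_act left op.
have op0 : op (inord 0) = X by rewrite /op eqxx.
have op1 : op (inord 1) = Y by rewrite /op eqxx -val_eqE /= !inordK.
have op2 : op (inord 2) = Z by rewrite /op -!val_eqE /= !inordK.
have actg i m : act (fgen k i) m = op i m.
  have -> : fgen k i = mul_at left (fgen k i) 1.
    by rewrite /mul_at mulr1 mul1r if_same.
  by rewrite /act free_act_gen free_act1.
have act00 p : act p 0 = 0.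
  rewrite /act /free_act big1 // => s _; rewrite /word_act.
  set t := (if _ then _ else _); suff -> : foldr (fun i => op i) 0 t = 0.
    by rewrite scaler0.
  by elim: t => //= i t ->; rewrite linear0.
have actM p q m : act (p * q) m = if left then act p (act q m) else act q (act p m).
  by have := @free_act_mul k 'I_3 left M op; rewrite /act /mul_at; case: left => ->.
have actD p q m : act (p + q) m = act p m + act q m.
  by rewrite -[p]scale1r /act free_actD !scale1r.
have actM2 p q f g m : act p =1 f -> act q =1 g ->
    act (p * q) m = if left then f (g m) else g (f m).
  by move=> ep eq; rewrite actM ep eq ep eq.
have actx : act (gx k) =1 X by move=> m; rewrite -op0; apply: actg.
have acty : act (gy k) =1 Y by move=> m; rewrite -op1; apply: actg.
have actz : act (gz k) =1 Z by move=> m; rewrite -op2; apply: actg.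
have act_ideal p m : tsideal_gen (relsA k) p -> act p m = 0.
  move=> Ip; elim: Ip m => {p} [r rr||p q _ IHp _ IHq|a p _ IH|p b _ IH] m.
  - move: rr; rewrite /relsA !inE => /or3P[] /eqP ->.
    + transitivity (act (gx k * gx k) m + act (gy k * gx k) m); first exact: actD.
      rewrite -[RHS](XX m); congr (_ + _); last exact: (actM2 _ _ _ _ m acty actx).
      by rewrite (actM2 _ _ _ _ m actx actx) if_same.
    + rewrite -[RHS](XZ m); exact: (actM2 _ _ _ _ m actx actz).
    + rewrite -[RHS](ZY m); exact: (actM2 _ _ _ _ m actz acty).
  - exact: free_act0.
  - by rewrite actD IHp IHq addr0.
  - by rewrite actM; case: left; rewrite IH ?act00.
  - by rewrite actM; case: left; rewrite IH ?act00.
(* Independence of the representative: two of them differ by an element of the ideal. *)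
have act_pi p m : act (lquot_repr (piA p)) m = act p m.
  set q := lquot_repr _.
  have /(act_ideal _ m) : tsideal_gen (relsA k) (q - p).
    apply: (proj1 (@qalg_piP k _ (presented_ideal (@const_coeff_relsA k)) q p)).
    exact: lquot_reprK.
  rewrite addrC -scaleN1r /act free_actD -/act scaleN1r => /eqP.
  by rewrite addrC subr_eq0 => /eqP.
pose h (a : algA k) := act (lquot_repr a) m0.
have h_pi p : h (piA p) = act p m0 by apply: act_pi.
have hlin : linear h.
  move=> c a b; have [p ->] := qalg_pi_surj a; have [q ->] := qalg_pi_surj b.
  rewrite -[qalg_pi _ p]/(piA p) -[qalg_pi _ q]/(piA q) -piAD !h_pi.
  exact: free_actD.
pose hL := GRing.isLinear.Build k (algA k) M _ h hlin.
pose H : {linear algA k -> M} := HB.pack h hL.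
exists H; split; first by rewrite -[LHS]/(h (piA 1)) h_pi [LHS]free_act1.
have HM i a : H (mul_at left (piA (fgen k i)) a) = op i (H a).
  have [p ->] := qalg_pi_surj a; rewrite -[qalg_pi _ p]/(piA p).
  have -> : mul_at left (piA (fgen k i)) (piA p) = piA (mul_at left (fgen k i) p).
    by rewrite /mul_at; case: left; rewrite piAM.
  by rewrite -[LHS]/(h _) -[H _]/(h _) !h_pi; apply: free_act_gen.
move=> a; split.
- by rewrite genx.unlock -op0; apply: (HM (inord 0)).
- by rewrite geny.unlock -op1; apply: (HM (inord 1)).
- by rewrite genz.unlock -op2; apply: (HM (inord 2)).
Qed.

End Generators.

(* [pA_rec] is the universal property: operators on M that satisfy the relations
   make M a left module (a right one when [left] is false), whence a map out of A. *)
Record presentedA (k : fieldType) (A : algType k) (x y z w : A) : Prop := {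
  pA_y : y = w - x;
  pA_wx : w * x = 0;
  pA_xz : x * z = 0;
  pA_zy : z * y = 0;
  pA_span : forall (left : bool) (P : A -> Prop),
    P 1 -> (forall c a b, P a -> P b -> P (c *: a + b)) ->
    (forall a, P a -> [/\ P (mul_at left x a), P (mul_at left y a)
                        & P (mul_at left z a)]) ->
    forall a, P a;
  pA_rec : forall (left : bool) (M : lmodType k) (X Y Z : {linear M -> M}),
    let comp (f g : M -> M) m := if left then f (g m) else g (f m) in
    (forall m, X (X m) + comp Y X m = 0) -> (forall m, comp X Z m = 0) ->
    (forall m, comp Z Y m = 0) ->
    forall m0 : M, exists h : {linear A -> M}, h 1 = m0 /\
      forall a, [/\ h (mul_at left x a) = X (h a), h (mul_at left y a) = Y (h a)
                  & h (mul_at left z a) = Z (h a)]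
}.

Lemma algA_presented (k : fieldType) :
  presentedA (genx k) (geny k) (genz k) (genw k).
Proof.
split.
- exact: gen_yE.
- exact: gen_wx.
- exact: gen_xz.
- exact: gen_zy.
- exact: algA_span_at.
- move=> left M X Y Z comp XX XZ ZY m0; exact: (algA_rec_at XX XZ ZY).
Qed.

(** * Linear recursion over A, decompositions into ideals, annihilators of the letters *)

Section Recursion.
Variables (k : fieldType) (A : algType k) (x y z w : A).
Hypothesis HA : presentedA x y z w.

(** Linearity on the direct sum of A and M, not bilinearity: paired with multiplication by a letter,
    such an [f] gives a linear operator on A x M. *)
Definition jlinear (M N : lmodType k) (f : A -> M -> N) :=
  forall c a b m n, f (c *: a + b) (c *: m + n) = c *: f a m + f b n.

(* The universal property applied to A * M, whose first component records the
   argument. Projections onto and divisions by the letters are all maps of this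
   form, so that no basis of A is ever needed. *)
Lemma rec_at (left : bool) (M : lmodType k) (m0 : M) (fw fx fz : A -> M -> M) :
  jlinear fw -> jlinear fx -> jlinear fz ->
  let comp f u g v a m :=
    if left then f (mul_at left v a) (g a m) else g (mul_at left u a) (f a m) in
  (forall a m, comp fw w fx x a m = 0) -> (forall a m, comp fx x fz z a m = 0) ->
  (forall a m, comp fz z fw w a m = comp fz z fx x a m) ->
  exists h : {linear A -> M}, h 1 = m0 /\
    forall a, [/\ h (mul_at left w a) = fw a (h a),
                  h (mul_at left x a) = fx a (h a)
                & h (mul_at left z a) = fz a (h a)].
Proof.
move=> lw lx lz comp Ewx Exz Ezy.
(* Forced by y = w - x; the third compatibility then says that [fz] after [fy] vanishes, as z y = 0
   demands. *)
pose fy a m := fw a m - fx a m.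
have ly : jlinear fy.
  by move=> c a b m n; rewrite /fy lw lx scalerBr opprD addrACA.
pose op u (f : A -> M -> M) (p : A * M) := (mul_at left u p.1, f p.1 p.2).
have op_lin u f : jlinear f -> linear (op u f).
  move=> lf c [a m] [b n]; rewrite /op /= lf mul_at_linear.
  by apply/eqP; rewrite xpair_eqE /= !eqxx.
pose X : {linear (A * M)%type -> (A * M)%type} :=
  HB.pack (op x fx) (GRing.isLinear.Build _ _ _ _ (op x fx) (op_lin x fx lx)).
pose Y : {linear (A * M)%type -> (A * M)%type} :=
  HB.pack (op y fy) (GRing.isLinear.Build _ _ _ _ (op y fy) (op_lin y fy ly)).
pose Z : {linear (A * M)%type -> (A * M)%type} :=
  HB.pack (op z fz) (GRing.isLinear.Build _ _ _ _ (op z fz) (op_lin z fz lz)).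
have jB (f : A -> M -> M) : jlinear f -> forall a b m n, f (a - b) (m - n) = f a m - f b n.
  move=> lf a b m n; have := lf (-1) b a n m.
  by rewrite !scaleN1r ![- _ + _]addrC.
have yB a : mul_at left y a = mul_at left w a - mul_at left x a.
  by rewrite (pA_y HA) /mul_at; case: (left); rewrite ?mulrBl ?mulrBr.
have XX p : X (X p) + (if left then Y (X p) else X (Y p)) = 0.
  case: p => a m; move: (Ewx a m) (yB); rewrite /comp /X /Y /= /op /mul_at /fy.
  case: (left) => /= E yB'; congr (_, _).
  - by rewrite yB' addrC subrK mulrA (pA_wx HA) mul0r.
  - by rewrite E sub0r subrr.
  - by rewrite yB' mulrBl addrC subrK -mulrA (pA_wx HA) mulr0.
  - by rewrite yB' (jB _ lx) E sub0r subrr.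
have XZ p : (if left then X (Z p) else Z (X p)) = 0.
  case: p => a m; move: (Exz a m); rewrite /comp /X /Z /= /op /mul_at.
  case: (left) => /= ->; congr (_, _); first by rewrite mulrA (pA_xz HA) mul0r.
  by rewrite -mulrA (pA_xz HA) mulr0.
have ZY p : (if left then Z (Y p) else Y (Z p)) = 0.
  case: p => a m; move: (Ezy a m) (yB); rewrite /comp /Y /Z /= /op /mul_at /fy.
  case: (left) => /= E yB'; congr (_, _).
  - by rewrite mulrA (pA_zy HA) mul0r.
  - by rewrite yB' (jB _ lz) E subrr.
  - by rewrite -mulrA (pA_zy HA) mulr0.
  - by rewrite E subrr.
have [h [h1 hM]] := pA_rec HA XX XZ ZY (1, m0).
(* The first component obeys the recursion of the identity, so the second one always sees the true
   argument. *)
have h_fst a : (h a).1 = a.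
  move: a; apply: (pA_span HA (left := left)) => [|c a b ea eb|a ea]; first by rewrite h1.
    by rewrite linearP /= ea eb.
  by have [-> -> ->] := hM a; rewrite /= ea.
pose g a := (h a).2.
have g_lin : linear g by move=> c a b; rewrite /g linearP.
pose G : {linear A -> M} := HB.pack g (GRing.isLinear.Build _ _ _ _ g g_lin).
exists G; rewrite /G /=.
split; first by rewrite /g h1.
have hp a : h a = (a, g a) by rewrite /g [LHS]surjective_pairing h_fst.
move=> a; have [hx hy hz] := hM a; rewrite /g.
have -> : mul_at left w a = mul_at left x a + mul_at left y a.
  by rewrite yB addrC subrK.
rewrite linearD hx hy hz hp /= /fy; split=> //.
by rewrite addrC subrK.
Qed.


Lemma rec_left (M : lmodType k) (m0 : M) (fw fx fz : A -> M -> M) :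
  jlinear fw -> jlinear fx -> jlinear fz ->
  (forall a m, fw (x * a) (fx a m) = 0) -> (forall a m, fx (z * a) (fz a m) = 0) ->
  (forall a m, fz (w * a) (fw a m) = fz (x * a) (fx a m)) ->
  exists h : {linear A -> M}, h 1 = m0 /\
    forall a, [/\ h (w * a) = fw a (h a), h (x * a) = fx a (h a)
                & h (z * a) = fz a (h a)].
Proof. exact: (@rec_at true). Qed.

Lemma rec_right (M : lmodType k) (m0 : M) (fw fx fz : A -> M -> M) :
  jlinear fw -> jlinear fx -> jlinear fz ->
  (forall a m, fx (a * w) (fw a m) = 0) -> (forall a m, fz (a * x) (fx a m) = 0) ->
  (forall a m, fw (a * z) (fz a m) = fx (a * z) (fz a m)) ->
  exists h : {linear A -> M}, h 1 = m0 /\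
    forall a, [/\ h (a * w) = fw a (h a), h (a * x) = fx a (h a)
                & h (a * z) = fz a (h a)].
Proof. exact: (@rec_at false). Qed.

Lemma span_left (P : A -> Prop) :
  P 1 -> (forall c a b, P a -> P b -> P (c *: a + b)) ->
  (forall a, P a -> [/\ P (w * a), P (x * a) & P (z * a)]) -> forall a, P a.
Proof.
move=> P1 PD PM; apply: (pA_span HA (left := true)) => // a Pa.
have [Pw Px Pz] := PM a Pa; rewrite /mul_at; split=> //.
by rewrite (pA_y HA) mulrBl addrC -scaleN1r; apply: PD.
Qed.

Lemma span_right (P : A -> Prop) :
  P 1 -> (forall c a b, P a -> P b -> P (c *: a + b)) ->
  (forall a, P a -> [/\ P (a * w), P (a * x) & P (a * z)]) -> forall a, P a.
Proof.
move=> P1 PD PM; apply: (pA_span HA (left := false)) => // a Pa.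
have [Pw Px Pz] := PM a Pa; rewrite /mul_at; split=> //.
by rewrite (pA_y HA) mulrBr addrC -scaleN1r; apply: PD.
Qed.

Let wx := pA_wx HA.
Let xz := pA_xz HA.
Let zy := pA_zy HA.
Let zx : z * x = z * w.
Proof. by apply/esym/eqP; rewrite -subr_eq0 -mulrBr -(pA_y HA) zy. Qed.

Lemma jlinear0 (M N : lmodType k) : jlinear (fun (_ : A) (_ : M) => 0 : N).
Proof. by move=> c a b m n; rewrite scaler0 addr0. Qed.

Lemma jlinear1 (M N : lmodType k) (f : A -> N) :
  linear f -> jlinear (fun a (_ : M) => f a).
Proof. by move=> lf c a b m n; apply: lf. Qed.

Lemma mull_linear (a : A) : linear (fun b => a * b).
Proof. by move=> c u v; rewrite mulrDr -scalerAr. Qed.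

Lemma mulr_linear (a : A) : linear (fun b => b * a).
Proof. by move=> c u v; rewrite mulrDl -scalerAl. Qed.

(** Recursion with zero operators gives a functional vanishing on uA for each letter u; induction on
    a shows that it vanishes on a u too. It reads off constant terms. *)
Lemma augmentation : exists e : {linear A -> k^o}, e 1 = 1 /\
  (forall a, [/\ e (w * a) = 0, e (x * a) = 0 & e (z * a) = 0]) /\
  (forall a, [/\ e (a * w) = 0, e (a * x) = 0 & e (a * z) = 0]).
Proof.
have j0 := @jlinear0 k^o k^o.
have [e [e1 eM]] : exists h : {linear A -> k^o}, h 1 = 1 /\
    forall a, [/\ h (w * a) = 0, h (x * a) = 0 & h (z * a) = 0].
  by apply: (rec_left 1 j0 j0 j0).
exists e; split=> //; split=> // a; have [ew ex ez] := eM 1.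
move: a; apply: span_left => [|c a b [Ea Eb Ec] [Fa Fb Fc]|a _].
- by rewrite !mul1r -[w]mulr1 -[x]mulr1 -[z]mulr1 ew ex ez.
- by rewrite !mulrDl -!scalerAl !linearP Ea Eb Ec Fa Fb Fc scaler0 addr0.
- by split; rewrite -!mulrA; split; do [by case: (eM (a * w))|
    by case: (eM (a * x))|by case: (eM (a * z))].
Qed.

(** Keeping only the words with a given first letter respects the relations: the three recursions
    are consistent by w x = 0, x z = 0 and z w = z x. *)
Lemma left_projections : exists pw px pz : {linear A -> A},
  [/\ pw 1 = 0, px 1 = 0 & pz 1 = 0] /\
  forall a, [/\ [/\ pw (w * a) = w * a, px (w * a) = 0 & pz (w * a) = 0],
                [/\ pw (x * a) = 0, px (x * a) = x * a & pz (x * a) = 0]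
              & [/\ pw (z * a) = 0, px (z * a) = 0 & pz (z * a) = z * a]].
Proof.
have j0 := @jlinear0 A A; have jM c := @jlinear1 A A _ (mull_linear c).
have E a b c : a * b = 0 -> a * (b * c) = 0 by move=> ab; rewrite mulrA ab mul0r.
have Ez a : z * (w * a) = z * (x * a) by rewrite !mulrA zx.
have [pw [pw1 pwM]] : exists h : {linear A -> A}, h 1 = 0 /\
    forall a, [/\ h (w * a) = w * a, h (x * a) = 0 & h (z * a) = 0].
  by apply: (rec_left 0 (jM w) j0 j0) => // a _; apply: E.
have [px [px1 pxM]] : exists h : {linear A -> A}, h 1 = 0 /\
    forall a, [/\ h (w * a) = 0, h (x * a) = x * a & h (z * a) = 0].
  by apply: (rec_left 0 j0 (jM x) j0) => // a _; apply: E.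
have [pz [pz1 pzM]] : exists h : {linear A -> A}, h 1 = 0 /\
    forall a, [/\ h (w * a) = 0, h (x * a) = 0 & h (z * a) = z * a].
  by apply: (rec_left 0 j0 j0 (jM z)) => // a _; apply: Ez.
exists pw, px, pz; split=> // a.
by have [[-> -> ->] [-> -> ->]] := (pwM a, pxM a); have [-> -> ->] := pzM a.
Qed.

Lemma left_decomp a : exists c a1 a2 a3, a = c%:A + w * a1 + x * a2 + z * a3.
Proof.
move: a; apply: span_left => [|c a b|a _].
- by exists 1, 0, 0, 0; rewrite !mulr0 scale1r !addr0.
- move=> [e [a1 [a2 [a3 ->]]]] [e' [b1 [b2 [b3 ->]]]].
  exists (c * e + e'), (c *: a1 + b1), (c *: a2 + b2), (c *: a3 + b3).
  rewrite !mulrDr -!scalerAr !scalerDr !scalerDl scalerA.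
  by do 3 (rewrite addrACA; congr (_ + _)).
- split.
  + by exists 0, a, 0, 0; rewrite !mulr0 scale0r add0r !addr0.
  + by exists 0, 0, a, 0; rewrite !mulr0 scale0r !add0r !addr0.
  + by exists 0, 0, 0, a; rewrite !mulr0 scale0r !add0r.
Qed.

(** The augmentation and the three projections separate the summands. Below, an equation in A is
    solved by comparing its components along k + wA + xA + zA. *)
Lemma left_direct c a1 a2 a3 : c%:A + w * a1 + x * a2 + z * a3 = 0 ->
  [/\ c = 0, w * a1 = 0, x * a2 = 0 & z * a3 = 0].
Proof.
have [pw [px [pz [[w1 x1 z1] pM]]]] := left_projections.
have [e [e1 [eM _]]] := augmentation.
move=> E; have ap (M : lmodType k) (h : {linear A -> M}) :
    c *: h 1 + h (w * a1) + h (x * a2) + h (z * a3) = 0.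
  by rewrite -linearZ -!linearD E linear0.
have [[? ? ?] [? ? ?] _] := (pM a1).
have [_ [E4 E5 E6] _] := pM a2; have [_ _ [E7 E8 E9]] := pM a3.
have [[E1 E2 E3] _ _] := pM a1.
split.
- have := ap _ e; rewrite e1; have [-> _ _] := eM a1; have [_ -> _] := eM a2.
  by have [_ _ ->] := eM a3; rewrite !addr0 => <-; rewrite [RHS]mulr1.
- by have := ap _ pw; rewrite w1 scaler0 E1 E4 E7 add0r !addr0.
- by have := ap _ px; rewrite x1 scaler0 E2 E5 E8 !add0r !addr0.
- by have := ap _ pz; rewrite z1 scaler0 E3 E6 E9 !add0r.
Qed.


Lemma jlinear_fun (M N : lmodType k) (f : {linear A -> N}) :
  jlinear (fun a (_ : M) => f a).
Proof. exact: jlinear1 (linearP f). Qed.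

Lemma linear_subid (f : {linear A -> A}) : linear (fun a => a - f a).
Proof. by move=> c a b; rewrite linearP scalerBr opprD addrACA. Qed.

(** For u = w, x, z a recursion sends u a to a minus its projection to the claimed ideal, which is
    consistent because this difference vanishes on the ideal. If u a = 0, then a equals its
    projection. *)
Lemma left_annihilators :
  [/\ forall a, w * a = 0 -> exists b, a = x * b,
      forall a, x * a = 0 -> exists b, a = z * b,
      forall a, z * a = 0 -> exists b, a = y * b
    & exists theta : {linear A -> A}, theta 1 = 0 /\ forall a, theta (y * a) = a].
Proof.
have [pw [px [pz [[w1 x1 z1] pM]]]] := left_projections.
have px_im a : exists b, px a = x * b.
  have [c [a1 [a2 [a3 ->]]]] := left_decomp a; exists a2.
  have [[_ E1 _] _ _] := (pM a1); have [_ [_ E2 _] _] := pM a2.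
  have [_ _ [_ E3 _]] := pM a3.
  by rewrite !linearD linearZ /= x1 scaler0 E1 E2 E3 !add0r addr0.
have pz_im a : exists b, pz a = z * b.
  have [c [a1 [a2 [a3 ->]]]] := left_decomp a; exists a3.
  have [[_ _ E1] _ _] := (pM a1); have [_ [_ _ E2] _] := pM a2.
  have [_ _ [_ _ E3]] := pM a3.
  by rewrite !linearD linearZ /= z1 scaler0 E1 E2 E3 !add0r.
have j0 := @jlinear0 A A.
have [hw [_ hwM]] : exists h : {linear A -> A}, h 1 = 0 /\
    forall a, [/\ h (w * a) = a - px a, h (x * a) = 0 & h (z * a) = 0].
  apply: (rec_left 0 (jlinear1 (M := A) (linear_subid px)) j0 j0) => // a _.
  by have [_ [_ -> _] _] := pM a; rewrite subrr.
have [hx [_ hxM]] : exists h : {linear A -> A}, h 1 = 0 /\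
    forall a, [/\ h (w * a) = 0, h (x * a) = a - pz a & h (z * a) = 0].
  apply: (rec_left 0 j0 (jlinear1 (M := A) (linear_subid pz)) j0) => // a _.
  by have [_ _ [_ _ ->]] := pM a; rewrite subrr.
have Npx : linear (fun a => - px a).
  by move=> c a b; rewrite linearP opprD scalerN.
(* Subtracting [px a] on wA and on xA keeps the recursion consistent with w x = 0 and x z = 0, and
   it cancels in y a = w a - x a. *)
have [theta [theta1 thetaM]] : exists h : {linear A -> A}, h 1 = 0 /\
    forall a, [/\ h (w * a) = a - px a, h (x * a) = - px a & h (z * a) = 0].
  apply: (rec_left 0 (jlinear1 (M := A) (linear_subid px)) (jlinear1 (M := A) Npx) j0) => // a _.
    by have [_ [_ -> _] _] := pM a; rewrite subrr.
  by have [_ _ [_ -> _]] := pM a; rewrite oppr0.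
have thetaK a : theta (y * a) = a.
  have [Ew Ex _] := thetaM a.
  by rewrite (pA_y HA) mulrBl linearB /= Ew Ex opprK subrK.
have ly : linear (fun a => a - y * theta a).
  move=> c a b; rewrite linearP mulrDr -scalerAr scalerBr opprD addrACA //.
(* The value on z a must be the same for w a and x a in place of a, that is, vanish on yA. *)
have [hz [_ hzM]] : exists h : {linear A -> A}, h 1 = 0 /\
    forall a, [/\ h (w * a) = 0, h (x * a) = 0 & h (z * a) = a - y * theta a].
  apply: (rec_left 0 j0 j0 (jlinear1 (M := A) ly)) => // a _.
  have -> : w * a = x * a + y * a by rewrite (pA_y HA) mulrBl addrC subrK.
  by rewrite linearD /= thetaK mulrDr opprD addrACA subrr addr0.
split.
- move=> a wa; have [b Eb] := px_im a; exists b; rewrite -Eb.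
  by have [] := hwM a; rewrite wa linear0 => /esym/eqP; rewrite subr_eq0 => /eqP.
- move=> a xa; have [b Eb] := pz_im a; exists b; rewrite -Eb.
  by have [_] := hxM a; rewrite xa linear0 => /esym/eqP; rewrite subr_eq0 => /eqP.
- move=> a za; exists (theta a).
  by have [_ _] := hzM a; rewrite za linear0 => /esym/eqP; rewrite subr_eq0 => /eqP.
- by exists theta.
Qed.

Lemma right_projection : exists p : {linear A -> A},
  (forall a, [/\ p (a * w) = 0, p (a * x) = 0 & p (a * z) = a * z]) /\
  forall a, exists b, p a = b * z.
Proof.
have j0 := @jlinear0 A A; have jM c := @jlinear1 A A _ (mulr_linear c).
have [p [p1 pM]] : exists h : {linear A -> A}, h 1 = 0 /\
    forall a, [/\ h (a * w) = 0, h (a * x) = 0 & h (a * z) = a * z].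
  by apply: (rec_right 0 j0 j0 (jM z)) => // a _; rewrite -mulrA xz mulr0.
exists p; split=> //; apply: span_right => [|c a b [a' Ea] [b' Eb]|a _].
- by exists 0; rewrite p1 mul0r.
- by exists (c *: a' + b'); rewrite linearP /= Ea Eb mulrDl scalerAl.
- have [-> -> ->] := pM a; split; [exists 0|exists 0|by exists a]; by rewrite mul0r.
Qed.

(** Division by letters, now from the right. The ideals Aw and Ax are not independent, as z x = z w.
    The last clause holds because the projection to Az kills Aw. *)
Lemma right_annihilators :
  [/\ forall a, a * x = 0 -> exists b, a = b * w,
      forall a, a * z = 0 -> exists b, a = b * x,
      forall a, a * y = 0 -> exists b, a = b * z
    & forall a b, a * w = b * z -> b * z = 0].
Proof.
have [p [pM p_im]] := right_projection.
have j0 := @jlinear0 A A; have jM c := @jlinear1 A A _ (mulr_linear c).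
have jp := @jlinear_fun A A p.
have jpM c : jlinear (fun a (_ : A) => p a * c).
  by move=> e a b _ _; rewrite /= linearP mulrDl scalerAl.
have azx a : a * z * x = a * z * w by rewrite -!mulrA zx.
(* [q] and [r] project onto Aw and Ax; both ideals contain Azx = Azw. *)
have [q [q1 qM]] : exists h : {linear A -> A}, h 1 = 0 /\
    forall a, [/\ h (a * w) = a * w, h (a * x) = p a * x & h (a * z) = 0].
  apply: (rec_right 0 (jM w) (jpM x) j0) => // a _.
    by have [-> _ _] := pM a; rewrite mul0r.
  by have [_ _ ->] := pM a; rewrite azx.
have [r [r1 rM]] : exists h : {linear A -> A}, h 1 = 0 /\
    forall a, [/\ h (a * w) = p a * w, h (a * x) = a * x & h (a * z) = 0].
  apply: (rec_right 0 (jpM w) (jM x) j0) => // a _.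
    by rewrite -mulrA wx mulr0.
  by have [_ _ ->] := pM a; rewrite azx.
have q_im a : exists b, q a = b * w.
  move: a; apply: span_right => [|c a b [a' Ea] [b' Eb]|a _].
  - by exists 0; rewrite q1 mul0r.
  - by exists (c *: a' + b'); rewrite linearP /= Ea Eb mulrDl scalerAl.
  - have [-> -> ->] := qM a; have [b ->] := p_im a; split; first by exists a.
      by exists (b * z); rewrite azx.
    by exists 0; rewrite mul0r.
have r_im a : exists b, r a = b * x.
  move: a; apply: span_right => [|c a b [a' Ea] [b' Eb]|a _].
  - by exists 0; rewrite r1 mul0r.
  - by exists (c *: a' + b'); rewrite linearP /= Ea Eb mulrDl scalerAl.
  - have [-> -> ->] := rM a; have [b ->] := p_im a; split; last 2 first.
    + by exists a.
    + by exists 0; rewrite mul0r.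
    by exists (b * z); rewrite azx.
(* The elements (a z) w and (a z) x coincide, and the second goes to a z; hence the value [p a] on a
   w. *)
have [hx [_ hxM]] : exists h : {linear A -> A}, h 1 = 0 /\
    forall a, [/\ h (a * w) = p a, h (a * x) = a - q a & h (a * z) = 0].
  apply: (rec_right 0 jp (jlinear1 (M := A) (linear_subid q)) j0) => // a _.
    by have [-> _ _] := qM a; rewrite subrr.
  by have [_ _ ->] := qM a; have [_ _ ->] := pM a; rewrite subr0.
have [hz [_ hzM]] : exists h : {linear A -> A}, h 1 = 0 /\
    forall a, [/\ h (a * w) = 0, h (a * x) = 0 & h (a * z) = a - r a].
  apply: (rec_right 0 j0 j0 (jlinear1 (M := A) (linear_subid r))) => // a _.
  by have [_ -> _] := rM a; rewrite subrr.
have [hy [_ hyM]] : exists h : {linear A -> A}, h 1 = 0 /\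
    forall a, [/\ h (a * w) = a - p a, h (a * x) = 0 & h (a * z) = 0].
  apply: (rec_right 0 (jlinear1 (M := A) (linear_subid p)) j0 j0) => // a _.
  by have [_ _ ->] := pM a; rewrite subrr.
split.
- move=> a ax; have [b Eb] := q_im a; exists b; rewrite -Eb.
  by have [_] := hxM a; rewrite ax linear0 => /esym/eqP; rewrite subr_eq0 => /eqP.
- move=> a az; have [b Eb] := r_im a; exists b; rewrite -Eb.
  by have [_ _] := hzM a; rewrite az linear0 => /esym/eqP; rewrite subr_eq0 => /eqP.
- move=> a ay; have [b Eb] := p_im a; exists b; rewrite -Eb.
  have [Ew Ex _] := hyM a; have : hy (a * y) = 0 by rewrite ay linear0.
  rewrite (pA_y HA) mulrBr linearB /= Ew Ex subr0 => /eqP.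
  by rewrite subr_eq0 => /eqP.
- by move=> a b E; have [_ _ <-] := pM b; rewrite -E; have [] := pM a.
Qed.

End Recursion.

(** * Curried Hochschild cochains as bimodules with twisted right action *)

Section CurriedCochains.
Variables (k : fieldType) (A : algType k).

(** Currying makes [ccoch n.+2] convertible to [A -> A -> ccoch n], so a change of the coefficient
    degree costs no reindexing. *)
Fixpoint ccoch (n : nat) : lmodType k :=
  if n is m.+1 then (A -> ccoch m : lmodType k) else A.

Fixpoint lact n (a : A) : ccoch n -> ccoch n :=
  if n is m.+1 return ccoch n -> ccoch n
  then fun phi : A -> ccoch m => fun b => lact a (phi b) else fun c : A => a * c.

(* The bimodule whose 0-cocycles and inner derivations are the n-cocycles and
   n-coboundaries; the right action of 1 is in general not the identity. *)
Fixpoint ract n : ccoch n -> A -> ccoch n :=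
  if n is m.+1 return ccoch n -> A -> ccoch n
  then fun (phi : A -> ccoch m) a b => phi (a * b) - ract (phi a) b
  else fun (c : A) a => c * a.

Fixpoint clinear n : ccoch n -> Prop :=
  if n is m.+1 return ccoch n -> Prop
  then fun phi : A -> ccoch m => (forall a, clinear (phi a)) /\ linear phi
  else fun _ => True.

(** In form the differential of a 0-cochain with values in [ccoch n]; the twist in [ract] makes it
    the Hochschild differential, see [hdiff_cuncurry]. *)
Definition cdiff n (phi : ccoch n) : ccoch n.+1 := fun a => lact a phi - ract phi a.

Lemma lact_linear n (a : A) : linear (@lact n a).
Proof.
elim: n => [|n IH] c u v; first exact: mull_linear.
by apply/funext => b; apply: IH.
Qed.

Lemma lactDl n c (a b : A) (phi : ccoch n) :
  lact (c *: a + b) phi = c *: lact a phi + lact b phi.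
Proof.
elim: n phi => [|n IH] phi; first exact: mulr_linear.
by apply/funext => d; apply: IH.
Qed.

Lemma lactM n (a b : A) (phi : ccoch n) : lact (a * b) phi = lact a (lact b phi).
Proof.
elim: n phi => [|n IH] phi; first exact: esym (mulrA _ _ _).
by apply/funext => d; apply: IH.
Qed.

Lemma ract_linear n (a : A) : linear (fun phi : ccoch n => ract phi a).
Proof.
elim: n a => [|n IH] a c u v; first exact: mulr_linear.
apply/funext => b; change (c *: u (a * b) + v (a * b)
  - ract (c *: (u : A -> ccoch n) a + (v : A -> ccoch n) a) b =
  c *: (u (a * b) - ract ((u : A -> ccoch n) a) b) +
  (v (a * b) - ract ((v : A -> ccoch n) a) b)).
by rewrite (IH b) scalerBr opprD addrACA.
Qed.

HB.instance Definition _ n (a : A) :=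
  GRing.isLinear.Build k (ccoch n) (ccoch n) _ (@lact n a) (lact_linear a).

Definition ractr n (a : A) (phi : ccoch n) := ract phi a.
HB.instance Definition _ n (a : A) :=
  GRing.isLinear.Build k (ccoch n) (ccoch n) _ (@ractr n a) (ract_linear a).

Lemma ractB n (phi psi : ccoch n) a : ract (phi - psi) a = ract phi a - ract psi a.
Proof. exact: (linearB (@ractr n a)). Qed.

Lemma ractD n (phi psi : ccoch n) a : ract (phi + psi) a = ract phi a + ract psi a.
Proof. exact: (linearD (@ractr n a)). Qed.

Lemma ractN n (phi : ccoch n) a : ract (- phi) a = - ract phi a.
Proof. exact: (linearN (@ractr n a)). Qed.

Lemma ract0 n a : ract (0 : ccoch n) a = 0.
Proof. exact: (linear0 (@ractr n a)). Qed.

Lemma lactDr n (phi psi : ccoch n) a : lact a (phi + psi) = lact a phi + lact a psi.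
Proof. exact: (linearD (@lact n a)). Qed.

Lemma lactBr n (phi psi : ccoch n) a : lact a (phi - psi) = lact a phi - lact a psi.
Proof. exact: (linearB (@lact n a)). Qed.

Lemma lactNr n (phi : ccoch n) a : lact a (- phi) = - lact a phi.
Proof. exact: (linearN (@lact n a)). Qed.

Lemma clinearD n c (phi psi : ccoch n) :
  clinear phi -> clinear psi -> clinear (c *: phi + psi).
Proof.
elim: n phi psi => [|n IH] phi psi //= [vphi lphi] [vpsi lpsi].
split=> [a|d u v]; first exact: (IH (phi a)).
change (c *: phi (d *: u + v) + psi (d *: u + v) =
  d *: (c *: phi u + psi u) + (c *: phi v + psi v)).
rewrite lphi lpsi !scalerDr !scalerA [c * d]mulrC.
by rewrite addrACA.
Qed.

Lemma clinear0 n : clinear (0 : ccoch n).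
Proof.
elim: n => [|n IH] //=; split=> [a|c u v]; first exact: IH.
by change (0 = c *: (0 : ccoch n) + 0); rewrite scaler0 addr0.
Qed.

Lemma clinearB n (phi psi : ccoch n) :
  clinear phi -> clinear psi -> clinear (phi - psi).
Proof. by move=> lphi lpsi; rewrite addrC -scaleN1r; apply: clinearD. Qed.

Lemma clinearN n (phi : ccoch n) : clinear phi -> clinear (- phi).
Proof. by move=> lphi; rewrite -sub0r; apply: clinearB => //; apply: clinear0. Qed.

Lemma clinear_lact n a (phi : ccoch n) : clinear phi -> clinear (lact a phi).
Proof.
elim: n phi => [|n IH] phi //= [vphi lphi]; split=> [b|c u v]; first exact: IH.
by rewrite lphi linearP.
Qed.

Lemma ractDr n c (a b : A) (phi : ccoch n) : clinear phi ->
  ract phi (c *: a + b) = c *: ract phi a + ract phi b.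
Proof.
elim: n phi c a b => [|n IH] phi c a b; first by move=> _; apply: mull_linear.
move=> [vphi lphi]; apply/funext => d.
change (phi ((c *: a + b) * d) - ract ((phi : A -> ccoch n) (c *: a + b)) d =
  c *: (phi (a * d) - ract ((phi : A -> ccoch n) a) d) +
  (phi (b * d) - ract ((phi : A -> ccoch n) b) d)).
rewrite mulrDl -scalerAl !lphi ract_linear scalerBr opprD.
by rewrite addrACA.
Qed.

Lemma clinear_ract n a (phi : ccoch n) : clinear phi -> clinear (ract phi a).
Proof.
elim: n phi a => [|n IH] phi a //= [vphi lphi]; split=> [b|c u v].
  by apply: clinearB => //; apply: IH.
rewrite mulrDr -scalerAr lphi ractDr // scalerBr opprD.
by rewrite addrACA.
Qed.

Lemma clinear_cdiff n (phi : ccoch n) : clinear phi -> clinear (cdiff phi).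
Proof.
move=> lphi; split=> [a|c u v].
  by apply: clinearB; [apply: clinear_lact|apply: clinear_ract].
by rewrite /cdiff lactDl ractDr // scalerBr opprD addrACA.
Qed.

(** At an argument c, the two terms that act on phi(a) by b c cancel by induction, leaving phi(a b
    c) minus phi(a b) acted on by c. *)
Lemma ractM n (a b : A) (phi : ccoch n) : ract (ract phi a) b = ract phi (a * b).
Proof.
elim: n a b phi => [|n IH] a b phi; first exact: esym (mulrA _ _ _).
apply/funext => c; rewrite /= ractB IH mulrA opprB addrA subrK.
by [].
Qed.

Lemma lact_ract n (a b : A) (phi : ccoch n) :
  lact a (ract phi b) = ract (lact a phi) b.
Proof.
elim: n a b phi => [|n IH] a b phi; first exact: mulrA.
apply/funext => c.
change (lact a (phi (b * c) - ract ((phi : A -> ccoch n) b) c) =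
  lact a (phi (b * c)) - ract (lact a ((phi : A -> ccoch n) b)) c).
by rewrite linearB /= IH.
Qed.

(** All terms cancel by associativity of the two actions and their commutation. *)
Lemma cdiff_cdiff n (phi : ccoch n) : cdiff (cdiff phi) = 0.
Proof.
apply/funext => a; apply/funext => b.
change (lact a (lact b phi - ract phi b) -
  ((lact (a * b) phi - ract phi (a * b)) - ract (lact a phi - ract phi a) b) = 0).
rewrite linearB ractB lactM ractM -lact_ract /=.
by rewrite (opprB (lact a (ract phi b))) addrA subrK subrr.
Qed.

Lemma cdiffB n (phi psi : ccoch n) : cdiff (phi - psi) = cdiff phi - cdiff psi.
Proof.
apply/funext => a; change (lact a (phi - psi) - ract (phi - psi) a =
  lact a phi - ract phi a - (lact a psi - ract psi a)).
by rewrite linearB ractB /= !opprD addrACA.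
Qed.

Lemma cdiffD n (phi psi : ccoch n) : cdiff (phi + psi) = cdiff phi + cdiff psi.
Proof. by rewrite -[in RHS](addrK psi phi) cdiffB subrK. Qed.

Lemma cdiff1P n (F : A -> ccoch n) : cdiff (F : ccoch n.+1) = 0 ->
  forall a b, F (a * b) = lact a (F b) + ract (F a) b.
Proof.
move=> dF a b; have := congr1 (fun f => (f : A -> A -> ccoch n) a b) dF.
change (lact a (F b) - (F (a * b) - ract (F a) b) = 0 ->
  F (a * b) = lact a (F b) + ract (F a) b).
by rewrite opprB addrA => /eqP; rewrite subr_eq0 => /eqP.
Qed.

Lemma cdiff2P n (F : A -> A -> ccoch n) : cdiff (F : ccoch n.+2) = 0 ->
  forall a b c, F (a * b) c = lact a (F b c) + F a (b * c) - ract (F a b) c.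
Proof.
move=> dF a b c; have := cdiff1P dF a b => /(congr1 (fun f => f c)) ->.
by change (lact a (F b c) + (F a (b * c) - ract (F a b) c) =
  lact a (F b c) + F a (b * c) - ract (F a b) c); rewrite addrA.
Qed.

End CurriedCochains.

(** * Curried cochains against functions of vectors *)

Section Currying.
Variables (k : fieldType) (A : algType k).

Definition consv n (a : A) (v : 'I_n -> A) : 'I_n.+1 -> A := fun i =>
  if unlift ord0 i is Some j then v j else a.

Definition tailv n (v : 'I_n.+1 -> A) : 'I_n -> A := fun j => v (lift ord0 j).

Lemma consv0 n a (v : 'I_n -> A) : consv a v ord0 = a.
Proof. by rewrite /consv unlift_none. Qed.

Lemma consvS n a (v : 'I_n -> A) j : consv a v (lift ord0 j) = v j.
Proof. by rewrite /consv liftK. Qed.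

Lemma consvK n (v : 'I_n.+1 -> A) : consv (v ord0) (tailv v) = v.
Proof. by apply/funext => i; rewrite /consv; case: unliftP => [j|] ->. Qed.

Lemma tail_consv n a (v : 'I_n -> A) : tailv (consv a v) = v.
Proof. by apply/funext => j; rewrite /tailv consvS. Qed.

Fixpoint cuncurry n : ccoch A n -> ('I_n -> A) -> A :=
  if n is m.+1 return ccoch A n -> ('I_n -> A) -> A
  then fun (phi : A -> ccoch A m) v => cuncurry (phi (v ord0)) (tailv v)
  else fun c _ => c.

(** In degree 0 the constant 0 merely denotes the only vector over an empty index type. *)
Fixpoint ccurry n : (('I_n -> A) -> A) -> ccoch A n :=
  if n is m.+1 return (('I_n -> A) -> A) -> ccoch A n
  then fun F => fun a => ccurry (fun v => F (consv a v))
  else fun F => F (fun _ => 0).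

Lemma ccurryK n (F : ('I_n -> A) -> A) : cuncurry (ccurry F) = F.
Proof.
elim: n F => [|n IH] F; apply/funext => v /=.
  by congr F; apply/funext => -[].
by rewrite IH consvK.
Qed.

Lemma cuncurryK n (phi : ccoch A n) : ccurry (cuncurry phi) = phi.
Proof.
elim: n phi => [|n IH] phi //=; apply/funext => a.
rewrite -[RHS]IH; congr ccurry; apply/funext => v.
by rewrite consv0 tail_consv.
Qed.

Lemma cuncurry_linear n c (phi psi : ccoch A n) v :
  cuncurry (c *: phi + psi) v = c *: cuncurry phi v + cuncurry psi v.
Proof. by elim: n phi psi v => [|n IH] phi psi v //=; rewrite -IH. Qed.

Lemma cuncurry0 n v : cuncurry (0 : ccoch A n) v = 0.
Proof. by elim: n v => [|n IH] v //=; apply: IH. Qed.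

Lemma cuncurryB n (phi psi : ccoch A n) v :
  cuncurry (phi - psi) v = cuncurry phi v - cuncurry psi v.
Proof. by rewrite addrC -scaleN1r cuncurry_linear scaleN1r addrC. Qed.

Lemma cuncurryN n (phi : ccoch A n) v : cuncurry (- phi) v = - cuncurry phi v.
Proof. by rewrite -[- phi]sub0r cuncurryB cuncurry0 sub0r. Qed.

Lemma cuncurry_lact n a (phi : ccoch A n) v :
  cuncurry (lact a phi) v = a * cuncurry phi v.
Proof. by elim: n phi v => [|n IH] phi v //=; apply: IH. Qed.

Lemma ccurry_linear n c (F G : ('I_n -> A) -> A) :
  ccurry (fun v => c *: F v + G v) = c *: ccurry F + ccurry G.
Proof.
elim: n F G => [|n IH] F G //=; apply/funext => a.
exact: (IH (fun v => F (consv a v)) (fun v => G (consv a v))).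
Qed.

Lemma eta_consv0 n a u (v : 'I_n -> A) :
  ([eta consv a v with ord0 |-> u] : 'I_n.+1 -> A) = consv u v.
Proof.
by apply/funext => i /=; rewrite /consv; case: unliftP => [j|] -> //=; rewrite eqxx.
Qed.

Lemma eta_consvS n a u (v : 'I_n -> A) i :
  ([eta consv a v with lift ord0 i |-> u] : 'I_n.+1 -> A) = consv a [eta v with i |-> u].
Proof.
by apply/funext => l /=; rewrite /consv; case: unliftP => [j|] -> //=.
Qed.

Lemma clinear_ccurry n (F : ('I_n -> A) -> A) : multilinear F -> clinear (ccurry F).
Proof.
elim: n F => [|n IH] F mF //=; split=> [a|c u v].
  by apply: IH => v i c b d; have := mF (consv a v) (lift ord0 i) c b d;
     rewrite !eta_consvS.
rewrite -ccurry_linear; congr ccurry; apply/funext => t.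
by have := mF (consv 0 t) ord0 c u v; rewrite !eta_consv0.
Qed.

Lemma multilinear_cuncurry n (phi : ccoch A n) : clinear phi -> multilinear (cuncurry phi).
Proof.
elim: n phi => [|n IH] phi; first by move=> _ v [].
move=> [vphi lphi] v i c a b; rewrite -(consvK v).
case: (unliftP ord0 i) => [j ->|->].
  rewrite !eta_consvS /= !consv0 !tail_consv; exact: (IH _ (vphi (v ord0))).
by rewrite !eta_consv0 /= !consv0 !tail_consv lphi cuncurry_linear.
Qed.

Lemma contract_head n (v : 'I_n.+2 -> A) :
  contract ord0 v = consv (v ord0 * v (lift ord0 ord0)) (tailv (tailv v)).
Proof.
apply/funext => i; rewrite /contract /consv ltn0.
case: unliftP => [j ->|->]; last first.
  by rewrite eqxx; congr (v _ * _); apply: val_inj.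
by rewrite eq_sym (negPf (neq_lift _ _)).
Qed.

Lemma contract_tail n (j : 'I_n) (v : 'I_n.+2 -> A) :
  contract (lift ord0 j) v = consv (v ord0) (contract j (tailv v)).
Proof.
apply/funext => i; rewrite /contract /consv.
have e (a b : 'I_n.+2) : a = b :> nat -> v a = v b by move=> /val_inj ->.
case: unliftP => [l ->|->] /=; last by apply: e.
rewrite (inj_eq lift_inj) /tailv /bump /= !add1n ltnS.
by case: ifP => _; [|case: ifP => _; [congr (_ * _)|]]; apply: e;
   rewrite /= /bump /= ?add1n.
Qed.

(** The Hochschild differential without its left multiplication, with the sign reversed: the
    uncurried [ract]. *)
Definition rdiff n (F : ('I_n -> A) -> A) (v : 'I_n.+1 -> A) : A :=
  \sum_(i < n) (-1) ^+ i * F (contract i v)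
  + (-1) ^+ n * (F (fun j => v (widen_ord (leqnSn n) j)) * v ord_max).

Lemma hdiff_rdiff n (F : ('I_n -> A) -> A) v :
  hdiff F v = v ord0 * F (tailv v) - rdiff F v.
Proof.
rewrite /hdiff /rdiff opprD addrA -sumrN; congr (_ + _ + _).
  by apply: eq_bigr => i _; rewrite exprS mulN1r mulNr.
by rewrite exprS mulN1r mulNr.
Qed.

(** Contracting the first two arguments a, b gives [phi (a * b)]; the other terms are those of
    [phi a], shifted by one position and hence of opposite sign. This is the recursion of [ract]. *)
Lemma rdiff_cuncurry n (phi : ccoch A n) v :
  rdiff (cuncurry phi) v = cuncurry (ract phi (v ord0)) (tailv v).
Proof.
elim: n phi v => [|n IH] phi v.
  rewrite /rdiff big_ord0 add0r expr0 mul1r /=; congr (_ * v _).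
  exact: val_inj.
change (rdiff (cuncurry phi) v = cuncurry ((phi : A -> _) (v ord0 * (tailv v) ord0)
  - ract ((phi : A -> _) (v ord0)) ((tailv v) ord0)) (tailv (tailv v))).
rewrite cuncurryB -IH /rdiff big_ord_recl expr0 mul1r contract_head /=.
rewrite consv0 tail_consv -!addrA; congr (_ + _).
rewrite opprD -sumrN; congr (_ + _).
  apply: eq_bigr => i _; rewrite contract_tail consv0 tail_consv.
  by rewrite [in LHS]exprS mulN1r mulNr.
have e (a b : 'I_n.+2) : a = b :> nat -> v a = v b by move=> /val_inj ->.
rewrite exprS mulN1r mulNr; congr (- (_ * (cuncurry ((phi : A -> _) _) _ * _))).
- exact: e.
- by apply/funext => j; apply: e.
- by apply: e.
Qed.

Lemma hdiff_cuncurry n (phi : ccoch A n) : hdiff (cuncurry phi) = cuncurry (cdiff phi).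
Proof.
apply/funext => v; rewrite hdiff_rdiff rdiff_cuncurry -cuncurry_lact.
by rewrite -cuncurryB.
Qed.

Lemma is_cocycle_ccurry n (F : ('I_n -> A) -> A) :
  is_cocycle F -> clinear (ccurry F) /\ cdiff (ccurry F) = 0.
Proof.
move=> [mF dF]; split; first exact: clinear_ccurry.
rewrite -[LHS]cuncurryK -hdiff_cuncurry ccurryK dF -[RHS]cuncurryK; congr ccurry.
by apply/funext => v; rewrite cuncurry0.
Qed.

Lemma is_coboundary_ccurry n (F : ('I_n.+1 -> A) -> A) (psi : ccoch A n) :
  clinear psi -> ccurry F = cdiff psi -> is_coboundary F.
Proof.
move=> lpsi E; exists (cuncurry psi); first exact: multilinear_cuncurry.
by rewrite hdiff_cuncurry -E ccurryK.
Qed.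

End Currying.

(** * Cocycles with bimodule values and their restriction to the relations *)

Section KoszulCochains.
Variables (k : fieldType) (A : algType k) (x y z w : A).
Hypothesis HA : presentedA x y z w.

Let yE := pA_y HA.
Let wx := pA_wx HA.
Let xz := pA_xz HA.
Let zy := pA_zy HA.

(** Since c = 1 c, right multiplication by c factors through the unital part [ract u 1]. *)
Lemma ract_mul1 n (u : ccoch A n) c : ract u 1 = 0 -> ract u c = 0.
Proof. by move=> u1; rewrite -[c]mul1r -ractM u1 ract0. Qed.

Lemma lactBl n (u : ccoch A n) a b : lact (a - b) u = lact a u - lact b u.
Proof. by rewrite [a - b]addrC -[- b]scaleN1r lactDl scaleN1r addrC. Qed.

Lemma lact0l n (u : ccoch A n) : lact 0 u = 0.
Proof. by rewrite -(subrr 0) lactBl subrr. Qed.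

Lemma ractBr n (u : ccoch A n) a b : clinear u -> ract u (a - b) = ract u a - ract u b.
Proof. by move=> lu; rewrite [a - b]addrC -[- b]scaleN1r ractDr // scaleN1r addrC. Qed.

Lemma ract0r n (u : ccoch A n) : clinear u -> ract u 0 = 0.
Proof. by move=> lu; rewrite -(subrr 0) ractBr // subrr. Qed.

Lemma lact1 n (u : ccoch A n) : lact 1 u = u.
Proof.
elim: n u => [|n IH] u; first exact: mul1r.
by apply/funext => a; apply: IH.
Qed.

(** Evaluate the hypothesis at 1, where the twist subtracts exactly this term. *)
Lemma ract_idem n (u : ccoch A n.+1) : ract u 1 = u -> ract ((u : A -> ccoch A n) 1) 1 = 0.
Proof.
move=> u1; have := congr1 (fun f => (f : A -> ccoch A n) 1) u1.
change ((u : A -> ccoch A n) (1 * 1) - ract ((u : A -> ccoch A n) 1) 1 =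
  (u : A -> ccoch A n) 1 -> ract ((u : A -> ccoch A n) 1) 1 = 0).
by rewrite mul1r => /eqP; rewrite -subr_eq0 addrC addrA addNr sub0r oppr_eq0 => /eqP.
Qed.

Section Linear.
Variables (n : nat) (phi : A -> ccoch A n).
Hypothesis lphi : clinear (phi : ccoch A n.+1).

Lemma clinB a b : phi (a - b) = phi a - phi b.
Proof. by rewrite [a - b]addrC -[- b]scaleN1r lphi.2 scaleN1r addrC. Qed.

Lemma clin0 : phi 0 = 0.
Proof. by rewrite -(subrr 0) clinB subrr. Qed.

End Linear.

(** The map is supported on words of length one: w a goes to e(a) [gw] with e the augmentation, and
    likewise for x and z. It serves to choose cochains with prescribed values on letters. *)
Lemma letter_map n (gw gx gz : ccoch A n) :
  clinear gw -> clinear gx -> clinear gz -> exists G : A -> ccoch A n,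
  [/\ clinear (G : ccoch A n.+1), G 1 = 0, G w = gw, G x = gx & G z = gz].
Proof.
move=> lw lx lz; have [e [e1 [eM _]]] := augmentation HA.
have lin (g : ccoch A n) : jlinear (fun a (_ : ccoch A n) => (e a : k) *: g).
  by move=> c a b _ _; rewrite linearP scalerDl scalerA.
have [h [h1 hM]] : exists h : {linear A -> ccoch A n}, h 1 = 0 /\
    forall a, [/\ h (w * a) = (e a : k) *: gw, h (x * a) = (e a : k) *: gx
                & h (z * a) = (e a : k) *: gz].
  apply: (rec_left HA 0 (lin gw) (lin gx) (lin gz)) => a _.
  - by have [_ -> _] := eM a; rewrite scale0r.
  - by have [_ _ ->] := eM a; rewrite scale0r.
  - by have [-> -> _] := eM a; rewrite !scale0r.
have hE : [/\ h w = gw, h x = gx & h z = gz].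
  have [] := hM 1; rewrite !mulr1 => -> -> ->.
  by rewrite e1 !scale1r.
exists h; have [-> -> ->] := hE; split=> //; split; last exact: linearP.
apply: (span_left HA) => [|c a b ha hb|a _]; first by rewrite h1; apply: clinear0.
  by rewrite linearP; apply: clinearD.
have lZ c (g : ccoch A n) : clinear g -> clinear (c *: g).
  by move=> lg; rewrite -[_ *: _]addr0; apply: clinearD => //; apply: clinear0.
by have [-> -> ->] := hM a; split; apply: lZ.
Qed.

Lemma cocycle1_eq0 n (F : A -> ccoch A n) : clinear (F : ccoch A n.+1) ->
  cdiff (F : ccoch A n.+1) = 0 -> F 1 = 0 -> F w = 0 -> F x = 0 -> F z = 0 ->
  forall a, F a = 0.
Proof.
move=> lF /cdiff1P FM F1 Fw Fx Fz.
apply: (span_left HA) => [|c a b Fa Fb|a Fa] //.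
  by rewrite lF.2 Fa Fb scaler0 addr0.
by rewrite !FM Fa Fw Fx Fz !linear0 !ract0 addr0.
Qed.

(* The square-zero extension A x ccoch n, twisted by the cocycle, is an
   A-module because the Koszul relations hold in it. *)
Lemma cocycle2_split n (F : A -> A -> ccoch A n) :
  clinear (F : ccoch A n.+2) -> cdiff (F : ccoch A n.+2) = 0 ->
  ract (F w x) 1 = 0 -> ract (F x z) 1 = 0 -> ract (F z y) 1 = 0 ->
  exists2 phi : ccoch A n.+1, clinear phi & (F : ccoch A n.+2) = cdiff phi.
Proof.
move=> lF dF Ewx Exz Ezy; have FM := cdiff2P dF.
have F0 b : F 0 b = 0 by rewrite (clin0 lF).
have lF2 a : linear (F a) by exact: (lF.1 a).2.
have lF1 c a b d : F (c *: a + b) d = c *: F a d + F b d by rewrite lF.2.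
have jF a : jlinear (fun b (m : ccoch A n) => lact a m - F a b).
  by move=> c b b' m m'; rewrite linearP /= lF2 scalerBr opprD addrACA.
(* The consistency check shared by the three relations: the twisted operators of a and b compose to
   zero. *)
have rel a b c (m : ccoch A n) : a * b = 0 -> ract (F a b) 1 = 0 ->
    lact a (lact b m - F b c) - F a (b * c) = 0.
  move=> ab Eab; have := FM a b c.
  rewrite ab F0 (ract_mul1 c Eab) subr0 => E.
  by rewrite linearB /= -lactM ab lact0l sub0r -opprD -E oppr0.
(* The value at 1 makes [ract (phi g) b] vanish for every letter g: it becomes g F(1, b) - g F(1,
   b). *)
have [phi [phi1 phiM]] : exists phi : {linear A -> ccoch A n}, phi 1 = F 1 1 /\
    forall a, [/\ phi (w * a) = lact w (phi a) - F w a,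
                  phi (x * a) = lact x (phi a) - F x a
                & phi (z * a) = lact z (phi a) - F z a].
  apply: (rec_left HA _ (jF w) (jF x) (jF z)) => a m; try exact: rel.
  have wE : w = x + y by rewrite yE addrC subrK.
  have -> : F z (w * a) = F z (x * a) + F z (y * a).
    by have := lF2 z 1 (x * a) (y * a); rewrite !scale1r wE mulrDl.
  have -> : lact w m - F w a = (lact x m - F x a) + (lact y m - F y a).
    have := lF1 1 x y a; have := lactDl 1 x y m; rewrite !scale1r -wE => -> ->.
    by rewrite opprD addrACA.
  by rewrite linearD opprD addrACA (rel z y a m zy Ezy) addr0.
have lphi : clinear ((phi : A -> ccoch A n) : ccoch A n.+1).
  have vF a b : clinear (F a b) by exact: ((lF.1 a).1 b).
  split; last exact: linearP.
  apply: (span_left HA) => [|c a b ha hb|a ha]; first by rewrite phi1.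
    by rewrite linearP; apply: clinearD.
  by have [-> -> ->] := phiM a; split; apply: clinearB => //; apply: clinear_lact.
exists (phi : A -> ccoch A n) => //.
pose F' : A -> A -> ccoch A n := fun a b =>
  F a b - (lact a (phi b) - (phi (a * b) - ract (phi a) b)).
have F'E : (F' : ccoch A n.+2) = F - cdiff ((phi : A -> ccoch A n) : ccoch A n.+1) by [].
suff F'0 : forall a, F' a = 0.
  apply/eqP; rewrite -subr_eq0; apply/eqP; rewrite -F'E.
  by apply/funext => a; rewrite F'0.
have addKK (u v t : ccoch A n) : t = u + t - v -> v = u.
  by rewrite addrAC => /eqP; rewrite -subr_eq subrr eq_sym subr_eq0 => /eqP.
have F1 b : ract (F 1 1) b = F 1 b.
  by have := FM 1 1 b; rewrite !mul1r lact1 => /addKK.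
have Fg a b : ract (F a 1) b = lact a (F 1 b).
  by have := FM a 1 b; rewrite mul1r mulr1 => /addKK.
have F'g g : (forall a, phi (g * a) = lact g (phi a) - F g a) -> F' g = 0.
  move=> phig; apply/funext => b; rewrite /F' phig.
  have -> : ract (phi g) b = 0.
    by rewrite -[g]mulr1 phig phi1 ractB -lact_ract F1 Fg subrr.
  by rewrite subr0 subKr subrr.
(* The difference is read as a derivation into [ccoch A n.+1], determined by its values at 1 and at
   the letters. *)
apply: (@cocycle1_eq0 n.+1 F').
- by rewrite F'E; apply: clinearB => //; apply: clinear_cdiff.
- by rewrite F'E cdiffB dF cdiff_cdiff subrr.
- by apply/funext => b; rewrite /F' lact1 mul1r subKr phi1 F1 subrr.
- by apply: F'g => b; have [] := phiM b.
- by apply: F'g => b; have [] := phiM b.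
- by apply: F'g => b; have [] := phiM b.
Qed.

End KoszulCochains.

(** * Koszul cochains of degrees 2 and 3 with values in a bimodule *)

Section KoszulVanishing.
Variables (k : fieldType) (A : algType k) (x y z w : A).
Hypothesis HA : presentedA x y z w.

Let yE := pA_y HA.
Let wx := pA_wx HA.
Let xz := pA_xz HA.
Let zy := pA_zy HA.

(* Degrees 2 and 3 of the Koszul complex with coefficients in ccoch A n, in the
   bases (w x, x z, z y) of V_2 and (w x z, x z y) of V_3; the right action of 1
   projects onto the unital part of ccoch A n. *)
Definition koszul2_cocycle n (e1 e2 e3 : ccoch A n) : Prop :=
  [/\ clinear e1, clinear e2 & clinear e3] /\
  [/\ ract e1 1 = e1, ract e2 1 = e2, ract e3 1 = e3,
      lact w e2 = ract e1 z & lact x e3 = ract e2 y].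

(** The unknowns are the values of a 1-cochain on w, x, z, so its value on y is [gw - gx]. *)
Definition koszul2_coboundary n (e1 e2 e3 : ccoch A n) : Prop :=
  exists gw gx gz : ccoch A n, [/\ clinear gw, clinear gx & clinear gz] /\
  [/\ e1 = ract (lact w gx + ract gw x) 1, e2 = ract (lact x gz + ract gx z) 1
    & e3 = ract (lact z (gw - gx) + ract gz y) 1].

(** The equation is the vanishing of the differential on w x z y, which spans V_4. *)
Definition koszul3_cocycle n (h1 h2 : ccoch A n) : Prop :=
  [/\ clinear h1, clinear h2, ract h1 1 = h1, ract h2 1 = h2
    & lact w h2 = - ract h1 y].

Definition koszul3_coboundary n (h1 h2 : ccoch A n) : Prop :=
  exists k1 k2 k3 : ccoch A n, [/\ clinear k1, clinear k2 & clinear k3] /\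
  h1 = ract (lact w k2 - ract k1 z) 1 /\ h2 = ract (lact x k3 - ract k2 y) 1.

(** For letters with a b = 0 and b c = 0 the cocycle identity at (a, b, c) collapses to a F(b, c) =
    F(a, b) c. *)
Lemma restr_cocycle n (F : A -> A -> ccoch A n) :
  clinear (F : ccoch A n.+2) -> cdiff (F : ccoch A n.+2) = 0 ->
  koszul2_cocycle (ract (F w x) 1) (ract (F x z) 1) (ract (F z y) 1).
Proof.
move=> lF dF; have FM := cdiff2P dF.
have lF1 a : clinear (F a : ccoch A n.+1) := lF.1 a.
have vF a b : clinear (F a b) := (lF1 a).1 b.
have rel a b c : a * b = 0 -> b * c = 0 -> lact a (F b c) = ract (F a b) c.
  move=> ab bc; have := FM a b c; rewrite ab bc (clin0 (lF1 a)) addr0.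
  have -> : F 0 c = 0 by rewrite (clin0 lF).
  by move/esym/eqP; rewrite subr_eq0 => /eqP.
split; first by split; apply: clinear_ract.
by split; rewrite ?ractM ?mulr1 // lact_ract ?(rel _ _ _ wx xz) ?(rel _ _ _ xz zy) ractM mul1r mulr1.
Qed.

(** Subtracting the coboundary of a 1-cochain with the given values on letters kills the unital
    parts on the relations, and [cocycle2_split] applies. *)
Lemma cocycle2_coboundary n (F : A -> A -> ccoch A n) :
  clinear (F : ccoch A n.+2) -> cdiff (F : ccoch A n.+2) = 0 ->
  koszul2_coboundary (ract (F w x) 1) (ract (F x z) 1) (ract (F z y) 1) ->
  exists2 phi : ccoch A n.+1, clinear phi & (F : ccoch A n.+2) = cdiff phi.
Proof.
move=> lF dF [gw [gx [gz [[lw lx lz] [E1 E2 E3]]]]].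
have [G [lG G1 Gw Gx Gz]] := letter_map HA lw lx lz.
have Gy : G y = gw - gx by rewrite yE (clinB lG) Gw Gx.
pose F' : A -> A -> ccoch A n := fun a b =>
  F a b - (lact a (G b) - (G (a * b) - ract (G a) b)).
have F'E : (F' : ccoch A n.+2) = F - cdiff (G : ccoch A n.+1) by [].
have F'rel a b : a * b = 0 ->
    F' a b = F a b - (lact a (G b) + ract (G a) b).
  by move=> ab; rewrite /F' ab (clin0 lG) sub0r opprK.
have [phi lphi Ephi] : exists2 phi : ccoch A n.+1, clinear phi &
    (F' : ccoch A n.+2) = cdiff phi.
  apply: (cocycle2_split HA).
  - by rewrite F'E; apply: clinearB => //; apply: clinear_cdiff.
  - by rewrite F'E cdiffB dF cdiff_cdiff subrr.
  - by rewrite (F'rel _ _ wx) ractB E1 Gw Gx subrr.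
  - by rewrite (F'rel _ _ xz) ractB E2 Gz Gx subrr.
  - by rewrite (F'rel _ _ zy) ractB E3 Gz Gy subrr.
exists (phi + (G : ccoch A n.+1)).
  by rewrite -[phi]scale1r; apply: clinearD.
by rewrite cdiffD -Ephi F'E subrK.
Qed.

(* The coboundary is found with gw = gx, so that gz is determined by e3 alone. *)
Lemma koszul2_coboundaryS0 n (e1 e2 e3 : A -> ccoch A n) :
  koszul2_cocycle (e1 : ccoch A n.+1) e2 e3 ->
  ract (e1 z) 1 = 0 -> ract (e2 y) 1 = 0 ->
  koszul2_coboundary (e1 : ccoch A n.+1) e2 e3.
Proof.
move=> [[l1 l2 l3] [i1 i2 i3 R12 R23]] Ez Ey.
have [_ _ _ [theta [theta1 thetaK]]] := left_annihilators HA.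
have r12 c : lact w (e2 c) = e1 (z * c).
  have : lact w (e2 c) = e1 (z * c) - ract (e1 z) c.
    by have := congr1 (fun f : A -> ccoch A n => f c) R12.
  by rewrite (ract_mul1 _ Ez) subr0.
have r23 c : lact x (e3 c) = e2 (y * c).
  have : lact x (e3 c) = e2 (y * c) - ract (e2 y) c.
    by have := congr1 (fun f : A -> ccoch A n => f c) R23.
  by rewrite (ract_mul1 _ Ey) subr0.
have e11 c : ract (e1 1) c = 0 := ract_mul1 c (ract_idem i1).
have e21 c : ract (e2 1) c = 0 := ract_mul1 c (ract_idem i2).
have e31 c : ract (e3 1) c = 0 := ract_mul1 c (ract_idem i3).
(* Solves the third equation, since theta divides by y. *)
pose gz c := e3 (theta c).
have lz : clinear (gz : ccoch A n.+1).
  by split=> [c|c a b]; [apply: l3.1|rewrite /gz linearP l3.2].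
have gzK c : gz (y * c) = e3 c by rewrite /gz thetaK.
have gz1 : gz 1 = 0 by rewrite /gz theta1 (clin0 l3).
have jx : jlinear (fun c (m : ccoch A n) => e1 c - lact w m).
  by move=> c a b m m'; rewrite linearP l1.2 scalerBr opprD addrACA.
have jz : jlinear (fun c (m : ccoch A n) => e2 c - lact x (gz c)).
  move=> c a b m m'; rewrite lz.2 linearP l2.2 scalerBr opprD.
  exact: addrACA.
(* The values on x a and z a are those that the first two equations require; they are consistent by
   w e2(a) = e1(z a) and x e3(a) = e2(y a). *)
have [g [g1 gM]] : exists g : {linear A -> ccoch A n}, g 1 = 0 /\
    forall a, [/\ g (w * a) = 0, g (x * a) = e1 a - lact w (g a)
                & g (z * a) = e2 a - lact x (gz a)].
  apply: (rec_left HA 0 (@jlinear0 _ A _ _) jx jz) => //= a m.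
    by rewrite linearB /= r12 -lactM wx lact0l subr0 subrr.
  have wE : w * a = x * a + y * a by rewrite yE mulrBl addrC subrK.
  have addE (f : A -> ccoch A n) b b' : clinear (f : ccoch A n.+1) ->
      f (b + b') = f b + f b'.
    by move=> lf; have := lf.2 1 b b'; rewrite !scale1r.
  by rewrite wE !addE // linearD /= gzK r23 opprD addrACA subrr addr0.
have lg : clinear ((g : A -> ccoch A n) : ccoch A n.+1).
  split; last exact: linearP.
  apply: (span_left HA) => [|c a b ha hb|a ha].
  - by rewrite g1; apply: clinear0.
  - by rewrite linearP; apply: clinearD.
  - have [-> -> ->] := gM a; split; first exact: clinear0.
      by apply: clinearB; [apply: l1.1|apply: clinear_lact].
    by apply: clinearB; [apply: l2.1|apply: clinear_lact; apply: lz.1].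
exists (g : A -> ccoch A n), (g : A -> ccoch A n), gz; split=> //.
have [gw gx gzz] := gM 1; rewrite !mulr1 in gw gx gzz.
split.
- rewrite -[LHS]i1; congr ract; apply/funext => c.
  change (e1 c = lact w (g c) + (g (x * c) - ract (g x) c)).
  have [_ -> _] := gM c.
  by rewrite gx g1 linear0 subr0 e11 subr0 addrC subrK.
- rewrite -[LHS]i2; congr ract; apply/funext => c.
  change (e2 c = lact x (gz c) + (g (z * c) - ract (g z) c)).
  have [_ _ ->] := gM c.
  by rewrite gzz gz1 linear0 subr0 e21 subr0 addrC subrK.
- rewrite -[LHS]i3; congr ract; rewrite subrr linear0 add0r; apply/funext => c.
  change (e3 c = gz (y * c) - ract (gz y) c).
  by rewrite gzK -[y]mulr1 gzK e31 subr0.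
Qed.

End KoszulVanishing.

(** * From degree 2 to degree 3, and solving the Koszul equations in degree 3 *)

Section KoszulVanishing3.
Variables (k : fieldType) (A : algType k) (x y z w : A).
Hypothesis HA : presentedA x y z w.

Let yE := pA_y HA.
Let wx := pA_wx HA.
Let xz := pA_xz HA.
Let zy := pA_zy HA.

Lemma clinear_add n (u v : ccoch A n) : clinear u -> clinear v -> clinear (u + v).
Proof. by move=> lu lv; rewrite -[u]scale1r; apply: clinearD. Qed.

(** Dimension shift: [e1] at z and [e2] at y are the values on w x z and x z y. The equation is the
    first relation evaluated at y, where e1(z y) = 0. *)
Lemma koszul2_eval n (e1 e2 e3 : A -> ccoch A n) :
  koszul2_cocycle x y z w (e1 : ccoch A n.+1) e2 e3 ->
  koszul3_cocycle y w (ract (e1 z) 1) (ract (e2 y) 1).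
Proof.
move=> [[l1 l2 _] [_ _ _ R12 _]]; split; rewrite ?ractM ?mulr1 //.
- by apply: clinear_ract; apply: l1.1.
- by apply: clinear_ract; apply: l2.1.
rewrite lact_ract mul1r.
have : lact w (e2 y) = e1 (z * y) - ract (e1 z) y.
  by have := congr1 (fun f : A -> ccoch A n => f y) R12.
by rewrite zy (clin0 l1) sub0r => ->; rewrite ractN ractM mulr1.
Qed.

(** A coboundary is subtracted so that the two evaluations vanish and [koszul2_coboundaryS0]
    applies. *)
Lemma koszul2_coboundaryS n (e1 e2 e3 : A -> ccoch A n) :
  koszul2_cocycle x y z w (e1 : ccoch A n.+1) e2 e3 ->
  koszul3_coboundary x y z w (ract (e1 z) 1) (ract (e2 y) 1) ->
  koszul2_coboundary x y z w (e1 : ccoch A n.+1) e2 e3.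
Proof.
move=> [[l1 l2 l3] [i1 i2 i3 R12 R23]] [k1 [k2 [k3 [[lk1 lk2 lk3] [E1 E2]]]]].
have c0 := clinear0 A n.
(* The letter maps realise [k1], [k2], [k3] as the values on w x, x z, z y: gw(x) = k1, gx(z) = k2
   and gz(y) = k3. *)
have [gw [lw gw1 gww gwx gwz]] := letter_map HA c0 lk1 c0.
have [gx [lx gx1 gxw gxx gxz]] := letter_map HA c0 c0 lk2.
have [gz [lz gz1 gzw gzx gzz]] := letter_map HA lk3 c0 c0.
have gzy : gz y = k3 by rewrite yE (clinB lz) gzw gzx subr0.
pose d1 : A -> ccoch A n := lact w (gx : ccoch A n.+1) + ract (gw : ccoch A n.+1) x.
pose d2 : A -> ccoch A n := lact x (gz : ccoch A n.+1) + ract (gx : ccoch A n.+1) z.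
pose d3 : A -> ccoch A n :=
  lact z ((gw : ccoch A n.+1) - gx) + ract (gz : ccoch A n.+1) y.
have ld1 : clinear (d1 : ccoch A n.+1).
  by apply: clinear_add; [apply: clinear_lact|apply: clinear_ract].
have ld2 : clinear (d2 : ccoch A n.+1).
  by apply: clinear_add; [apply: clinear_lact|apply: clinear_ract].
have ld3 : clinear (d3 : ccoch A n.+1).
  by apply: clinear_add; [apply: clinear_lact; apply: clinearB|apply: clinear_ract].
have d1E c : d1 c = lact w (gx c) + (gw (x * c) - ract (gw x) c) by [].
have d2E c : d2 c = lact x (gz c) + (gx (z * c) - ract (gx z) c) by [].
pose f1 : ccoch A n.+1 := (e1 : ccoch A n.+1) - ract (d1 : ccoch A n.+1) 1.
pose f2 : ccoch A n.+1 := (e2 : ccoch A n.+1) - ract (d2 : ccoch A n.+1) 1.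
pose f3 : ccoch A n.+1 := (e3 : ccoch A n.+1) - ract (d3 : ccoch A n.+1) 1.
have Z a b (u : ccoch A n.+1) : clinear u -> a * b = 0 -> ract (ract u a) b = 0.
  by move=> lu ab; rewrite ractM ab ract0r.
have L a b (u : ccoch A n.+1) : a * b = 0 -> lact a (lact b u) = 0.
  by move=> ab; rewrite -lactM ab lact0l.
have D12 : lact w (ract (d2 : ccoch A n.+1) 1) = ract (ract (d1 : ccoch A n.+1) 1) z.
  rewrite lact_ract ractM mul1r /d1 /d2 lactDr (L w x) // add0r.
  by rewrite ractD (Z x z) // addr0 -lact_ract ractM mulr1 lact_ract.
have D23 : lact x (ract (d3 : ccoch A n.+1) 1) = ract (ract (d2 : ccoch A n.+1) 1) y.
  rewrite lact_ract ractM mul1r /d2 /d3 lactDr (L x z) // add0r.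
  by rewrite ractD (Z z y) // addr0 -lact_ract ractM mulr1 lact_ract.
have Hf : koszul2_cocycle x y z w f1 f2 f3.
  split; first by split; apply: clinearB => //; apply: clinear_ract.
  split; rewrite /f1 /f2 /f3.
  - by rewrite ractB i1 ractM mulr1.
  - by rewrite ractB i2 ractM mulr1.
  - by rewrite ractB i3 ractM mulr1.
  - by rewrite lactBr ractB R12 D12.
  - by rewrite lactBr ractB R23 D23.
have f1z : ract ((f1 : A -> ccoch A n) z) 1 = 0.
  change (ract (e1 z - (d1 (1 * z) - ract (d1 1) z)) 1 = 0).
  rewrite mul1r !d1E mulr1 gx1 gwx gxz xz (clin0 lw) linear0 !add0r.
  rewrite ractB E1 -ractB; apply/eqP; rewrite ractB subr_eq0; apply/eqP.
  by rewrite !ractB !ractM !mul1r !mulr1 subrr subr0.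
have f2y : ract ((f2 : A -> ccoch A n) y) 1 = 0.
  change (ract (e2 y - (d2 (1 * y) - ract (d2 1) y)) 1 = 0).
  rewrite mul1r !d2E mulr1 gz1 gxz gzy zy (clin0 lx) linear0 !add0r.
  rewrite ractB E2 -ractB; apply/eqP; rewrite ractB subr_eq0; apply/eqP.
  by rewrite !ractB !ractM !mul1r !mulr1 subrr subr0.
have [hw [hx [hz [[lhw lhx lhz] [F1 F2 F3]]]]] :=
  koszul2_coboundaryS0 (e1 := f1) (e2 := f2) (e3 := f3) HA Hf f1z f2y.
exists (hw + (gw : ccoch A n.+1)), (hx + (gx : ccoch A n.+1)),
  (hz + (gz : ccoch A n.+1)).
split; first by split; apply: clinear_add.
have E a b (u u' v v' : ccoch A n.+1) :
    ract (lact a (u + u') + ract (v + v') b) 1 =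
    ract (lact a u + ract v b) 1 + ract (lact a u' + ract v' b) 1.
  by rewrite -ractD lactDr (ractD v) addrACA.
split.
- by rewrite E -F1 subrK.
- by rewrite E -F2 subrK.
- by rewrite opprD addrACA E -F3 subrK.
Qed.

(** With h1 = c + w a1 + x a2 + z a3, comparison of components forces c = 0, puts x a2 + z a3 in Az
    and a1 y + h2 in xA; the witnesses are read off. *)
Lemma koszul3_coboundary0 (h1 h2 : A) :
  w * h2 = - (h1 * y) -> koszul3_coboundary x y z w (h1 : ccoch A 0) h2.
Proof.
move=> E; have [c [a1 [a2 [a3 h1E]]]] := left_decomp HA h1.
have [kw kx _ _] := left_annihilators HA; have [_ _ ky _] := right_annihilators HA.
have [e [e1 [eM eM']]] := augmentation HA.
have [| _ Ew Ex Ez] := @left_direct _ _ _ _ _ _ HA 0 (c%:A + a1 * y + h2)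
    (a2 * y - c%:A) (a3 * y).
  transitivity (h1 * y + w * h2); last by rewrite E addrN.
  have cy : c *: y = c *: w - c *: x by rewrite yE scalerBr.
  rewrite scale0r add0r h1E !mulrDl !mulrDr mulrN -!scalerAr !mulr1 -scalerAl.
  by rewrite mul1r cy !mulrA (AC (3*2*1) (1*5*2*4*6*3)).
(* The element a2 y - c lies in zA, and the augmentation kills both zA and a2 y. *)
have c0 : c = 0.
  have [b Eb] := kx _ Ex; have := congr1 e Eb.
  rewrite linearB linearZ /= e1; have [_ _ ->] := eM b.
  have [Ew' Ex' _] := eM' a2.
  rewrite yE mulrBr linearB /= Ew' Ex' subrr sub0r => /eqP.
  by rewrite oppr_eq0 => /eqP; rewrite -[RHS]/(0 : k) => <-; rewrite [RHS]mulr1.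
have [d Ed] : exists d, a1 * y + h2 = x * d.
  by apply: kw; rewrite -Ew c0 scale0r add0r.
have [f Ef] : exists f, x * a2 + z * a3 = f * z.
  apply: ky; rewrite mulrDl -!mulrA Ez addr0 -Ex c0 scale0r subr0 //.
exists (- f), a1, d; split=> //=; split.
  by rewrite mulr1 mulNr opprK -Ef h1E c0 scale0r add0r addrA.
by rewrite mulr1 -Ed addrC addKr.
Qed.

(** Solved with [k3] zero: the second equation prescribes [k2] on yA, the first one [k1] on zA. The
    latter must vanish on z y a, which is the cocycle equation. *)
Lemma koszul3_coboundaryS0 n (h1 h2 : A -> ccoch A n) :
  koszul3_cocycle y w (h1 : ccoch A n.+1) h2 -> ract (h1 y) 1 = 0 ->
  koszul3_coboundary x y z w (h1 : ccoch A n.+1) h2.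
Proof.
move=> [l1 l2 i1 i2 R] Ey.
have [_ _ _ [theta [theta1 thetaK]]] := left_annihilators HA.
have r c : lact w (h2 c) = - h1 (y * c).
  have : lact w (h2 c) = - (h1 (y * c) - ract (h1 y) c).
    by have := congr1 (fun f : A -> ccoch A n => f c) R.
  by rewrite (ract_mul1 _ Ey) subr0.
pose k2 c := - h2 (theta c).
have lk2 : clinear (k2 : ccoch A n.+1).
  split=> [c|c a b]; first by apply: clinearN; apply: l2.1.
  by rewrite /k2 linearP l2.2 opprD scalerN.
have k2K c : k2 (y * c) = - h2 c by rewrite /k2 thetaK.
have k21 : k2 1 = 0 by rewrite /k2 theta1 (clin0 l2) oppr0.
have jz : jlinear (fun c (_ : ccoch A n) => lact w (k2 c) - h1 c).
  move=> c a b m m'; rewrite lk2.2 linearP l1.2 scalerBr opprD.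
  exact: addrACA.
have j0 := @jlinear0 _ A (ccoch A n) (ccoch A n).
have [g [g1 gM]] : exists g : {linear A -> ccoch A n}, g 1 = 0 /\
    forall a, [/\ g (w * a) = 0, g (x * a) = 0
                & g (z * a) = lact w (k2 a) - h1 a].
  apply: (rec_left HA 0 j0 j0 jz) => //= a _.
  have wE : w * a = x * a + y * a by rewrite yE mulrBl addrC subrK.
  have addE (f : A -> ccoch A n) b b' : clinear (f : ccoch A n.+1) ->
      f (b + b') = f b + f b'.
    by move=> lf; have := lf.2 1 b b'; rewrite !scale1r.
  by rewrite wE !addE // lactDr k2K lactNr r opprK opprD addrACA subrr addr0.
have lg : clinear ((g : A -> ccoch A n) : ccoch A n.+1).
  split; last exact: linearP.
  apply: (span_left HA) => [|c a b ha hb|a ha].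
  - by rewrite g1; apply: clinear0.
  - by rewrite linearP; apply: clinearD.
  - have [-> -> ->] := gM a; split; try exact: clinear0.
    by apply: clinearB; [apply: clinear_lact; apply: lk2.1|apply: l1.1].
exists (g : A -> ccoch A n), k2, 0; split; first by split=> //; apply: clinear0.
have h11 c : ract (h1 1) c = 0 := ract_mul1 c (ract_idem i1).
have h21 c : ract (h2 1) c = 0 := ract_mul1 c (ract_idem i2).
split.
  rewrite -[LHS]i1; congr ract; apply/funext => c.
  change (h1 c = lact w (k2 c) - (g (z * c) - ract (g z) c)).
  have [_ _ ->] := gM c; have [_ _] := gM 1; rewrite mulr1 => ->.
  by rewrite k21 linear0 sub0r ractN h11 oppr0 subr0 subKr.
rewrite -[LHS]i2; congr ract; apply/funext => c; rewrite linear0 sub0r.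
change (h2 c = - (k2 (y * c) - ract (k2 y) c)).
by rewrite k2K -[y]mulr1 k2K ractN h21 oppr0 subr0 opprK.
Qed.

(** Reduction to [koszul3_coboundaryS0]: changing [k1] by [g] changes h1 by g z, whose value at y is
    - g(z) y; so g(z) is chosen with g(z) y equal to the unital part of h1(y). *)
Lemma koszul3_coboundarySS n (h1 h2 : A -> ccoch A n.+1) :
  koszul3_cocycle y w (h1 : ccoch A n.+2) h2 ->
  koszul3_coboundary x y z w (h1 : ccoch A n.+2) h2.
Proof.
move=> [l1 l2 i1 i2 R].
have [_ _ _ [theta [theta1 thetaK]]] := left_annihilators HA.
pose la : A -> ccoch A n := ract (h1 y) 1.
have lla : clinear (la : ccoch A n.+1) by apply: clinear_ract; apply: l1.1.
have ila : ract (la : ccoch A n.+1) 1 = la by rewrite /la ractM mulr1.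
(* Chosen so that t(y c) = la(c); the correction term in the twisted action of y vanishes because
   [la] is fixed by 1. *)
pose t c := la (theta c).
have lt : clinear (t : ccoch A n.+1).
  by split=> [c|c a b]; [apply: lla.1|rewrite /t linearP lla.2].
have tE : ract (t : ccoch A n.+1) y = la.
  apply/funext => c; change (t (y * c) - ract (t y) c = la c).
  have tK b : t (y * b) = la b by rewrite /t thetaK.
  by rewrite tK -[y in t y]mulr1 tK (ract_mul1 c (ract_idem ila)) subr0.
have c0 := clinear0 A n.+1.
have [g [lg g1 gw gx gz]] := letter_map HA c0 c0 lt.
pose f1 : A -> ccoch A n.+1 :=
  (h1 : ccoch A n.+2) + ract (ract (g : ccoch A n.+2) z) 1.
have Hf : koszul3_cocycle y w (f1 : ccoch A n.+2) h2.
  split=> //.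
  - by apply: clinear_add => //; do 2 apply: clinear_ract.
  - by rewrite ractD i1 ractM mulr1.
  - by rewrite ractD !ractM mul1r zy ract0r // addr0.
have f1y : ract (f1 y) 1 = 0.
  have -> : f1 y = h1 y + (g (z * (1 * y)) - ract (g z) (1 * y)
     - ract (g (z * 1) - ract (g z) 1) y) by [].
  rewrite mul1r zy (clin0 lg) sub0r mulr1 gz tE ractB ractM mul1r tE subrr subr0.
  by rewrite ractD ractN ila subrr.
have [k1 [k2 [k3 [[lk1 lk2 lk3] [E1 E2]]]]] := koszul3_coboundaryS0 Hf f1y.
exists (k1 + (g : ccoch A n.+2)), k2, k3; split.
  by split=> //; apply: clinear_add.
split=> //; apply: (addIr (ract (ract (g : ccoch A n.+2) z) 1)).
rewrite -[LHS]/(f1 : ccoch A n.+2) E1 -ractD; congr ract.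
have subrDK (V : zmodType) (a b c : V) : a - b = a - (b + c) + c.
  by rewrite opprD addrA subrK.
by rewrite ractD; apply: subrDK.
Qed.

End KoszulVanishing3.

(** * Vanishing criteria in degrees 3, 4 and above, the center, and equations between ideals *)

Section LowDegrees.
Variables (k : fieldType) (A : algType k) (x y z w : A).
Hypothesis HA : presentedA x y z w.

Let yE := pA_y HA.
Let wx := pA_wx HA.
Let xz := pA_xz HA.
Let zy := pA_zy HA.
Let zx : z * x = z * w.
Proof. by apply/esym/eqP; rewrite -subr_eq0 -mulrBr -yE zy. Qed.

Lemma cocycle2P n (F : ('I_n.+2 -> A) -> A) : is_cocycle F ->
  let phi : A -> A -> ccoch A n := ccurry F in
  koszul2_coboundary x y z w (ract (phi w x) 1) (ract (phi x z) 1) (ract (phi z y) 1) ->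
  is_coboundary F.
Proof.
move=> /is_cocycle_ccurry[lF dF] phi K.
have [psi lpsi E] := cocycle2_coboundary HA lF dF K.
exact: is_coboundary_ccurry lpsi E.
Qed.

Lemma cocycle3_coboundary (F : ('I_3 -> A) -> A) : is_cocycle F -> is_coboundary F.
Proof.
move=> cF; apply: (cocycle2P cF); have [lF dF] := is_cocycle_ccurry cF.
have K := restr_cocycle HA lF dF; apply: (koszul2_coboundaryS HA K).
have [_ _ _ _ E] := koszul2_eval HA K.
exact: koszul3_coboundary0 HA _ _ E.
Qed.

(** The obstruction is the value on w x z y, which is obtained from F(w, x) by evaluation. *)
Lemma cocycle4_coboundary (F : ('I_4 -> A) -> A) : is_cocycle F ->
  (ccurry F : A -> A -> ccoch A 2) w x = 0 -> is_coboundary F.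
Proof.
move=> cF F0; apply: (cocycle2P cF); have [lF dF] := is_cocycle_ccurry cF.
have K := restr_cocycle HA lF dF; apply: (koszul2_coboundaryS HA K).
apply: (koszul3_coboundaryS0 HA (koszul2_eval HA K)).
have e0 : (ract ((ccurry F : A -> A -> ccoch A 2) w x) 1 : A -> ccoch A 1) z = 0.
  by rewrite F0 ract0.
have h0 : ract ((ract ((ccurry F : A -> A -> ccoch A 2) w x) 1 : A -> ccoch A 1) z) 1
    = 0 by rewrite e0 ract0.
by have := congr1 (fun h : A -> ccoch A 0 => ract (h y) 1) h0; rewrite [RHS]mul0r.
Qed.

Lemma cocycle5_coboundary n (F : ('I_n -> A) -> A) : (4 < n)%N ->
  is_cocycle F -> is_coboundary F.
Proof.
case: n F => [|[|[|[|[|n]]]]] F // _ cF.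
apply: (cocycle2P cF); have [lF dF] := is_cocycle_ccurry cF.
have K := restr_cocycle HA lF dF; apply: (koszul2_coboundaryS HA K).
exact: (@koszul3_coboundarySS _ _ _ _ _ _ HA n _ _ (koszul2_eval HA K)).
Qed.

(** Right division by w; its value [p a] on a x agrees with z w = z x. *)
Lemma right_regular_w (a : A) : a * w = 0 -> a = 0.
Proof.
have [p [pM _]] := right_projection HA.
have j0 := @jlinear0 _ A A A; have jp := jlinear_fun (M := A) p.
have j1 : jlinear (fun b _ : A => b) by [].
have [h [_ hM]] : exists h : {linear A -> A}, h 1 = 0 /\
    forall a, [/\ h (a * w) = a, h (a * x) = p a & h (a * z) = 0].
  apply: (rec_right HA 0 j1 jp j0) => // b _; first by have [] := pM b.
  by have [_ _ ->] := pM b.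
by move=> aw; have [<- _ _] := hM a; rewrite aw linear0.
Qed.

(** Components of c w = w c, together with right cancellation of w, leave c = l + w c1. Then x c = c
    x equates an element of xA with one of wA, so x w c1 = 0; hence w c1 lies in wA and in zA, and
    is 0. *)
Lemma center_scalar (c : A) : w * c = c * w -> x * c = c * x ->
  exists l : k, c = l%:A.
Proof.
move=> wc xc; have [l [c1 [c2 [c3 E]]]] := left_decomp HA c.
have [_ kx _ _] := left_annihilators HA.
have [| _ _ X2 Z3] := @left_direct _ _ _ _ _ _ HA 0 (l%:A + c1 * w - c)
    (c2 * w) (c3 * w).
  transitivity (c * w - w * c); last by rewrite wc subrr.
  rewrite {2}E !mulrDl !mulrDr mulrN -!scalerAr !mulr1 -scalerAl mul1r scale0r.
  by rewrite add0r !mulrA (AC (3*1*1) (1*2*4*5*3)).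
have X2' : x * c2 = 0 by apply: right_regular_w; rewrite -mulrA.
have Z3' : z * c3 = 0 by apply: right_regular_w; rewrite -mulrA.
have {}E : c = l%:A + w * c1 by rewrite {1}E X2' Z3' !addr0.
have [| _ _ X1 _] := @left_direct _ _ _ _ _ _ HA 0 (c1 * x) (- (w * c1)) 0.
  rewrite scale0r add0r mulr0 addr0; apply/eqP; rewrite mulrN subr_eq0.
  have := xc; rewrite E mulrDl mulrDr -scalerAl -scalerAr mul1r mulr1 => /addrI ->.
  by rewrite mulrA.
move: X1; rewrite mulrN => /eqP; rewrite oppr_eq0 => /eqP /kx [b Eb].
have [| _ W1 _ _] := @left_direct _ _ _ _ _ _ HA 0 c1 0 (- b).
  by rewrite scale0r add0r mulr0 addr0 mulrN Eb subrr.
by exists l; rewrite E W1 addr0.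
Qed.

Lemma aug_zero (c : k) (a b : A) : c%:A + a * z = y * b -> c = 0.
Proof.
have [e [e1 [eM eM']]] := augmentation HA => /(congr1 e).
have [_ _ az] := eM' a; have [wb xb _] := eM b.
rewrite linearD linearZ /= az e1 addr0 yE mulrBl linearB /= wb xb subr0 => <-.
by rewrite [RHS]mulr1.
Qed.

(** In components the equation forces the constant term of g to vanish, and the part of g outside wA
    is annihilated by z on the right, hence lies in Ax. *)
Lemma wA_cap_Az (g h : A) : w * h = g * z -> exists a e, g = w * a + e * x.
Proof.
move=> E; have [c [a1 [a2 [a3 gE]]]] := left_decomp HA g.
have [_ _ kz _] := left_annihilators HA; have [_ kz' _ _] := right_annihilators HA.
have [| _ _ X2 Z3] := @left_direct _ _ _ _ _ _ HA 0 (a1 * z - h)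
    (a2 * z) (c%:A + a3 * z).
  transitivity (g * z - w * h); last by rewrite E subrr.
  rewrite gE !mulrDl !mulrDr mulrN -!scalerAr !mulr1 -scalerAl mul1r scale0r.
  by rewrite add0r !mulrA (AC (2*1*2) (4*1*3*5*2)).
have [b Eb] := kz _ Z3; have c0 := aug_zero Eb.
have [e Ee] : exists e, x * a2 + z * a3 = e * x.
  apply: kz'; rewrite mulrDl -!mulrA X2 add0r -Z3 c0 scale0r add0r //.
by exists a1, e; rewrite gE c0 scale0r add0r -Ee addrA.
Qed.

(** Meant for p = D x and q = D z with D a derivation, where D(x z) = 0. The terms x b and - b z are
    halves of the inner derivation by b. *)
Lemma xA_cap_Az (p q : A) : x * q + p * z = 0 ->
  exists b e d, p = x * b + e * x /\ q = z * d - b * z.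
Proof.
move=> E; have [c [a1 [a2 [a3 pE]]]] := left_decomp HA p.
have [_ kx kz _] := left_annihilators HA; have [_ kz' _ _] := right_annihilators HA.
have [| _ W1 X2 Z3] := @left_direct _ _ _ _ _ _ HA 0 (a1 * z)
    (a2 * z + q) (c%:A + a3 * z).
  rewrite -[RHS]E pE !mulrDl !mulrDr -!scalerAr !mulr1 -scalerAl mul1r scale0r.
  by rewrite add0r !mulrA (AC (1*2*2) (3*(4*1*2*5))).
have [b Eb] := kz _ Z3; have c0 := aug_zero Eb.
have [e Ee] : exists e, w * a1 + z * a3 = e * x.
  apply: kz'; rewrite mulrDl -!mulrA W1 add0r -Z3 c0 scale0r add0r //.
have [d Ed] := kx _ X2; exists a2, e, d; split.
  by rewrite pE c0 scale0r add0r -Ee addrAC addrC.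
by rewrite -Ed addrC addKr.
Qed.

End LowDegrees.

(** * Normal forms of 1- and 2-cocycles, and cup products in positive degrees *)

Section CupProducts.
Variables (k : fieldType) (A : algType k) (x y z w : A).
Hypothesis HA : presentedA x y z w.

Let yE := pA_y HA.
Let wx := pA_wx HA.
Let xz := pA_xz HA.
Let zy := pA_zy HA.
Let zx : z * x = z * w.
Proof. by apply/esym/eqP; rewrite -subr_eq0 -mulrBr -yE zy. Qed.

Lemma cocycle_shift n (f : cocycle A n.+1) (psi : ccoch A n) : clinear psi ->
  exists2 f' : cocycle A n.+1, hclass f' = hclass f &
    ccurry (cocycle_fun f') = ccurry (cocycle_fun f) - cdiff psi.
Proof.
move=> lpsi; have [lf df] := is_cocycle_ccurry (cocycleP f).
pose phi : ccoch A n.+1 := ccurry (cocycle_fun f) - cdiff psi.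
have lphi : clinear phi by apply: clinearB => //; apply: clinear_cdiff.
have cphi : is_cocycle (cuncurry phi).
  split; first exact: multilinear_cuncurry.
  rewrite hdiff_cuncurry cdiffB df cdiff_cdiff subrr.
  by apply/funext => v; apply: cuncurry0.
have phiK : ccurry (cuncurry phi) = phi by apply: cuncurryK.
exists (mk_cocycle cphi); last exact: phiK.
apply/hclassP; apply: (is_coboundary_ccurry (psi := - psi)); first exact: clinearN.
rewrite -[- psi]sub0r cdiffB.
have -> : cdiff (0 : ccoch A n) = 0 by rewrite -[X in cdiff X](subrr psi) cdiffB subrr.
have -> : cocycle_fun (mk_cocycle cphi) - cocycle_fun f = cuncurry (- cdiff psi).
  apply/funext => v; rewrite cuncurryN.
  change (cuncurry phi v - cocycle_fun f v = - cuncurry (cdiff psi) v).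
  by rewrite /phi cuncurryB ccurryK addrAC subrr sub0r.
by rewrite cuncurryK sub0r.
Qed.

Definition derivation1 (f : cocycle A 1) : A -> A := ccurry (cocycle_fun f).

Lemma derivation1M (f : cocycle A 1) a b :
  derivation1 f (a * b) = a * derivation1 f b + derivation1 f a * b.
Proof.
have [_ /cdiff1P df] := is_cocycle_ccurry (cocycleP f); exact: df.
Qed.

Lemma derivation1_linear (f : cocycle A 1) : linear (derivation1 f).
Proof. by have [[_ +] _] := is_cocycle_ccurry (cocycleP f). Qed.

Lemma derivation1B (f : cocycle A 1) a b :
  derivation1 f (a - b) = derivation1 f a - derivation1 f b.
Proof.
by rewrite [a - b]addrC -[- b]scaleN1r derivation1_linear scaleN1r addrC.
Qed.

Lemma derivation1_0 (f : cocycle A 1) : derivation1 f 0 = 0.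
Proof. by rewrite -[X in derivation1 f X](subrr 0) derivation1B subrr. Qed.

Lemma inner_shift (f : cocycle A 1) (c : A) : exists2 f' : cocycle A 1,
  hclass f' = hclass f &
  forall a, derivation1 f' a = derivation1 f a - (a * c - c * a).
Proof.
have [f' Ef E] := @cocycle_shift 0 f c I.
by exists f' => // a; rewrite /derivation1 E.
Qed.

(** The clauses give w D x = 0, (D x) z = 0 and (D z) y in zAw, which controls a cup product on w x,
    x z and z y. *)
Definition normal1 (f : cocycle A 1) : Prop :=
  [/\ exists m, derivation1 f x = x * m, exists m, derivation1 f x = m * x &
      exists b p r, derivation1 f z = z * (b%:A + p * w + r * z)].

Lemma right_decomp (a : A) : exists c p q r, a = c%:A + p * w + q * x + r * z.
Proof.
move: a; apply: (span_right HA) => [|c a b|a _].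
- by exists 1, 0, 0, 0; rewrite !mul0r scale1r !addr0.
- move=> [e [a1 [a2 [a3 ->]]]] [e' [b1 [b2 [b3 ->]]]].
  exists (c * e + e'), (c *: a1 + b1), (c *: a2 + b2), (c *: a3 + b3).
  rewrite !mulrDl -!scalerAl !scalerDr !scalerDl scalerA.
  by do 3 (rewrite addrACA; congr (_ + _)).
- split.
  + by exists 0, a, 0, 0; rewrite !mul0r scale0r add0r !addr0.
  + by exists 0, 0, a, 0; rewrite !mul0r scale0r !add0r !addr0.
  + by exists 0, 0, 0, a; rewrite !mul0r scale0r !add0r.
Qed.

(** Here s is a polynomial in x, recorded through three properties. For a x, the term e w dies by w
    x = 0 and (u z) x = (u z) w becomes the new e w. *)
Lemma poly_decomp (a : A) : exists s e u, a = s + e * w + u * z /\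
  [/\ exists (b : k) s', s = b%:A + x * s', exists t, z * s * x = t * w
    & exists t, w * s = t * w].
Proof.
move: a; apply: (span_right HA) => [|c a b|a].
- exists 1, 0, 0; rewrite !mul0r !addr0; split=> //; split.
  + by exists 1, 0; rewrite scale1r mulr0 addr0.
  + by exists z; rewrite mulr1 zx.
  + by exists 1; rewrite mulr1 mul1r.
- move=> [s [e [u [-> [[b1 [s1 E1]] [t1 F1] [t2 F2]]]]]].
  move=> [s' [e' [u' [-> [[b1' [s1' E1']] [t1' F1'] [t2' F2']]]]]].
  exists (c *: s + s'), (c *: e + e'), (c *: u + u'); split.
    rewrite !mulrDl -!scalerAl !scalerDr.
    by do 2 (rewrite addrACA; congr (_ + _)).
  split.
  + exists (c * b1 + b1'), (c *: s1 + s1').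
    by rewrite E1 E1' scalerDr mulrDr -scalerAr scalerDl scalerA addrACA.
  + exists (c *: t1 + t1').
    by rewrite mulrDr mulrDl -scalerAr -!scalerAl F1 F1' mulrDl -scalerAl.
  + by exists (c *: t2 + t2'); rewrite mulrDr -scalerAr F2 F2' mulrDl -scalerAl.
- move=> [s [e [u [E [[b1 [s1 E1]] [t1 F1] [t2 F2]]]]]].
  have zero : [/\ exists (b : k) s', 0 = b%:A + x * s',
      exists t, z * 0 * x = t * w & exists t, w * 0 = t * w].
    split; first by exists 0, 0; rewrite scale0r mulr0 addr0.
      by exists 0; rewrite mulr0 !mul0r.
    by exists 0; rewrite mulr0 mul0r.
  split.
  + by exists 0, a, 0; split; [rewrite mul0r addr0 add0r|exact: zero].
  + exists (s * x), (u * z), 0; split.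
      rewrite mul0r addr0 E !mulrDl -mulrA wx mulr0 addr0.
      by rewrite -[u * z * x]mulrA zx mulrA.
    split.
    * exists 0, (b1%:A + s1 * x).
      by rewrite scale0r add0r E1 mulrDl mulrDr -scalerAl -scalerAr mul1r mulr1 mulrA.
    * by exists 0; rewrite mulrA F1 -mulrA wx mulr0 mul0r.
    * by exists 0; rewrite mulrA F2 -mulrA wx mulr0 mul0r.
  + by exists 0, 0, a; split; [rewrite mul0r !add0r|exact: zero].
Qed.

Lemma normal1_exists (f0 : cocycle A 1) :
  exists2 f : cocycle A 1, hclass f = hclass f0 & normal1 f.
Proof.
have [kw kx kz _] := left_annihilators HA.
have [kw' _ _ AzAw] := right_annihilators HA.
(* D(x z) = 0; subtracting the inner derivation by b puts D x in Ax and D z in zA. *)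
have [|b [e [d [Ep Eq]]]] := @xA_cap_Az _ _ _ _ _ _ HA (derivation1 f0 x)
    (derivation1 f0 z).
  by rewrite -derivation1M xz derivation1_0.
have [f1 cl1 E1] := inner_shift f0 b.
have E1x : derivation1 f1 x = (e + b) * x.
  rewrite E1 Ep opprB [LHS](AC (2*2) (1*4*2*3)) /=.
  by rewrite subrr add0r mulrDl.
have E1z : derivation1 f1 z = z * (d - b).
  by rewrite E1 Eq opprB [LHS](AC (2*2) (2*3*1*4)) /= addNr add0r mulrBr.
(* The second shift, by q x, removes the Ax part of the cofactor of D z; D x stays in Ax. *)
have [be [p [q [r Eb]]]] := right_decomp (d - b).
have [f2 cl2 E2] := inner_shift f1 (q * x).
pose a := e + b - x * q + q * x.
have E2x : derivation1 f2 x = a * x.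
  by rewrite E2 E1x opprB /a [in RHS]mulrDl [in RHS]mulrBl !mulrA [LHS](AC (1*2) (1*3*2)).
have E2z : derivation1 f2 z = z * (be%:A + p * w + r * z).
  rewrite E2 E1z Eb -[q * x * z]mulrA xz mulr0 subr0 -mulrBr; congr (_ * _).
  by rewrite addrAC addrK.
(* From D(w x) = 0. *)
have [g Eg] : exists g, derivation1 f2 w + w * a = g * w.
  apply: kw'; have := derivation1M f2 w x.
  by rewrite wx derivation1_0 E2x => Ew; rewrite mulrDl -mulrA addrC -Ew.
have E2w : derivation1 f2 w = g * w - w * a by rewrite -Eg addrK.
have wy : w * y = w * w by rewrite yE mulrBr wx subr0.
have mulzy b' p' r' : z * (b'%:A + p' * w + r' * z) * y = z * p' * w * w.
  rewrite -mulrA !mulrDl -[p' * w * y]mulrA wy -[r' * z * y]mulrA zy mulr0 addr0.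
  by rewrite -scalerAl mul1r mulrDr -scalerAr zy scaler0 add0r !mulrA.
(* From D(z y) = 0, where y = w - x. *)
have [t Et] : exists t, z * (w * a + a * x) = t * w.
  exists (z * g + z * p * w); have := derivation1M f2 z y.
  have -> : derivation1 f2 y = g * w - (w * a + a * x).
    by rewrite yE derivation1B E2w E2x opprD addrA.
  rewrite zy derivation1_0 E2z mulzy mulrBr addrAC => /esym/eqP.
  by rewrite subr_eq0 => /eqP <-; rewrite mulrDl mulrA.
have [s [e' [u [Ea [[b1 [s' Es]] [t1 F1] [t2 F2]]]]]] := poly_decomp a.
have ax : a * x = s * x + u * z * x by rewrite Ea !mulrDl -[e' * w * x]mulrA wx mulr0 addr0.
(* In z (w a + a x), which lies in Aw, every term except z w u z is visibly in Aw; so this one is in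
   both Aw and Az. *)
have zwuz : z * w * u * z = 0.
  have wa : w * a = t2 * w + w * e' * w + w * u * z by rewrite Ea !mulrDr F2 !mulrA.
  apply: (AzAw (t - (z * t2 + z * w * e' + t1 + z * u * z))).
  apply/eqP; rewrite mulrBl -Et subr_eq wa ax -[u * z * x]mulrA zx !mulrDr !mulrDl.
  by rewrite !mulrA F1 [X in X == _](AC (3*2) (3*(1*2*4*5))).
(* Now w u z lies in yA; since y = w - x, comparing the wA and xA parts gives u z = z q' + x r'. *)
have [v Ev] : exists v, w * (u * z) = y * v by apply: kz; rewrite !mulrA.
have [| _ W1 X1 _] := @left_direct _ _ _ _ _ _ HA 0 (u * z - v) v 0.
  rewrite scale0r add0r mulr0 addr0 mulrBr Ev yE mulrBl addrAC subrK.
  by rewrite subrr.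
have [q' Eq'] := kx _ X1; have [r' Er'] := kw _ W1.
have [c [u1 [u2 [u3 Eu]]]] := left_decomp HA u.
pose v' := c%:A + z * u3.
(* Both sides are the zA part of u z. *)
have Ev' : z * q' = v' * z.
  have [| _ _ _] := @left_direct _ _ _ _ _ _ HA 0 (u1 * z) (u2 * z - r')
    (c%:A + u3 * z - q').
    transitivity (u * z - v - x * r'); last by rewrite Er' subrr.
    rewrite Eu Eq' !mulrDl !mulrDr !mulrN -!scalerAr mulr1 -scalerAl mul1r.
    by rewrite scale0r add0r !mulrA [LHS](AC (1*2*3) (4*1*2*5*6*3)).
  rewrite mulrBr => /eqP; rewrite subr_eq0 => /eqP <-.
  by rewrite /v' mulrDr mulrDl -scalerAr -scalerAl mulr1 mul1r mulrA.
have uz : u * z = z * q' + x * r' by rewrite -Er' Eq' addrC subrK.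
(* As x z = 0, the third shift just removes z q' x from D x; in D z it only changes the cofactor r,
   because z q' = v' z. *)
have [f3 cl3 E3] := inner_shift f2 (- (z * q')).
exists f3; first by rewrite cl3 cl2.
have E3x : derivation1 f3 x = (s + x * r') * x.
  rewrite E3 E2x mulrN mulNr opprK [x * (z * q')]mulrA xz mul0r oppr0 add0r.
  by rewrite ax uz !mulrDl [LHS](AC (1*2*1) (1*3*(2*4))) /= subrr addr0.
split.
- exists ((b1%:A + s' * x) + r' * x); rewrite E3x Es.
  by rewrite !mulrDl !mulrDr -scalerAl -scalerAr mul1r mulr1 !mulrA.
- by exists (s + x * r').
exists be, p, (r + v' - q').
have -> : be%:A + p * w + (r + v' - q') * z =
    (be%:A + p * w + r * z) + (v' * z - q' * z).
  by rewrite mulrBl mulrDl !addrA.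
rewrite E3 E2z mulrN mulNr opprK [in RHS]mulrDr [in RHS]mulrBr -Ev'.
by rewrite opprD opprK !mulrA.
Qed.

Lemma consv_lshift m n a (v : 'I_(m + n) -> A) :
  (fun i : 'I_m.+1 => consv a v (lshift n i : 'I_(m.+1 + n))) =
  consv a (fun i => v (lshift n i)).
Proof.
apply/funext => i; rewrite {2}/consv; case: unliftP => [j|] ->.
  rewrite (_ : lshift n (lift ord0 j) = lift ord0 (lshift n j)) ?consvS //.
  exact: val_inj.
by rewrite (_ : lshift n ord0 = ord0) ?consv0 //; apply: val_inj.
Qed.

Lemma consv_rshift m n a (v : 'I_(m + n) -> A) :
  (fun j : 'I_n => consv a v (rshift m.+1 j : 'I_(m.+1 + n))) =
  (fun j => v (rshift m j)).
Proof.
apply/funext => j; rewrite (_ : rshift m.+1 j = lift ord0 (rshift m j)) ?consvS //.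
exact: val_inj.
Qed.

Lemma cup11_coboundary (f g : cocycle A 1) : normal1 f -> normal1 g ->
  is_coboundary (cochain_cup f g).
Proof.
move=> [[m fx] [m' fx'] [b [p [r fz]]]] [[n gx] [n' gx'] [b' [p' [r' gz]]]].
have [kw' _ _ _] := right_annihilators HA.
(* Since w D x = 0, the identity D(w x) = 0 leaves (D w) x = 0. *)
have w_im (h : cocycle A 1) l : derivation1 h x = x * l ->
    exists t, derivation1 h w = t * w.
  move=> hx; apply: kw'; have := derivation1M h w x.
  by rewrite wx derivation1_0 hx mulrA wx mul0r add0r.
have [t ft] := w_im f m fx; have [t' gt] := w_im g n gx.
have wy : w * y = w * w by rewrite yE mulrBr wx subr0.
have zgy : z * derivation1 g y = - (z * p' * w * w).
  have := derivation1M g z y; rewrite zy derivation1_0 => /esym/eqP.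
  rewrite addr_eq0 => /eqP ->; rewrite gz -mulrA !mulrDl -[p' * w * y]mulrA wy.
  rewrite -[r' * z * y]mulrA zy mulr0 addr0 -scalerAl mul1r mulrDr -scalerAr zy.
  by rewrite scaler0 add0r !mulrA.
have wgy : w * derivation1 g y = w * t' * w.
  by rewrite yE derivation1B gx gt mulrBr !mulrA wx mul0r subr0.
have fgzy : derivation1 f z * derivation1 g y =
    z * (p * w * t' - b *: (p' * w) - r * z * p' * w) * w.
  transitivity (z * (p * (w * t' * w)) + b *: - (z * p' * w * w)
      + z * (r * - (z * p' * w * w))).
    rewrite fz -mulrA !mulrDl -scalerAl mul1r -[p * w * _]mulrA wgy.
    by rewrite -[r * z * _]mulrA zgy !mulrDr -scalerAr zgy [X in X + _]addrC.
  by rewrite !mulrBr !mulrBl -scalerAr -scalerAl scalerN !mulrN !mulrA.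
have cupE a c : (ccurry (cochain_cup f g) : A -> A -> A) a c =
    - (derivation1 f a * derivation1 g c).
  rewrite /= /cochain_cup expr1 mulN1r (consv_lshift a) (consv_rshift a).
  congr (- (cocycle_fun f (consv a _) * cocycle_fun g _)).
    by apply/funext => -[].
  apply/funext => i; rewrite /consv -[X in unlift _ X](_ : i = _) //.
  exact: val_inj.
have cF : @is_cocycle k A 2 (cochain_cup f g) := cup_cocycle f g.
apply: (cocycle2P HA cF).
set S := p * w * t' - b *: (p' * w) - r * z * p' * w in fgzy.
(* A 1-cochain vanishing on x and z: it bounds the value - z S w on z y and contributes S w x = 0 on
   w x. *)
exists (- (S * w)), 0, 0; split=> //; split.
- change ((ccurry (cochain_cup f g) : A -> A -> A) w x * 1
    = (w * 0 + - (S * w) * x) * 1).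
  rewrite cupE ft gx mulr0 add0r !mulr1 mulNr -[S * w * x]mulrA wx mulr0.
  by rewrite mulrA -[t * w * x]mulrA wx mulr0 mul0r.
- change ((ccurry (cochain_cup f g) : A -> A -> A) x z * 1
    = (x * 0 + 0 * z) * 1).
  rewrite cupE fx' gz mulr0 mul0r addr0.
  by rewrite mulrA -[m' * x * z]mulrA xz mulr0 mul0r oppr0.
- change ((ccurry (cochain_cup f g) : A -> A -> A) z y * 1
    = (z * (- (S * w) - 0) + 0 * y) * 1).
  by rewrite cupE fgzy !mulr1 subr0 mul0r addr0 mulrN mulrA.
Qed.

(** The cocycle identity at (w, x, z) and [wA_cap_Az] give the value w a + e x on (w, x), the
    coboundary of a letter map with w to e and x to a. *)
Lemma normal2_exists (f0 : cocycle A 2) : exists2 f : cocycle A 2,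
  hclass f = hclass f0 & (ccurry (cocycle_fun f) : A -> A -> A) w x = 0.
Proof.
have [lf df] := is_cocycle_ccurry (cocycleP f0).
pose phi : A -> A -> A := ccurry (cocycle_fun f0).
have E : w * phi x z = phi w x * z.
  have [_ [_ _ _ E _]] := restr_cocycle HA lf df.
  by change (w * (phi x z * 1) = phi w x * 1 * z) in E; rewrite !mulr1 in E.
have [a [e Ea]] := wA_cap_Az HA E.
have [G [lG G1 Gw Gx Gz]] := @letter_map _ _ _ _ _ _ HA 0 e a 0 I I I.
have [f cl Ef] := cocycle_shift f0 lG; exists f => //; rewrite Ef.
change (phi w x - (w * G x - (G (w * x) - G w * x)) = 0).
by rewrite wx (clin0 lG) sub0r opprK Gw Gx Ea subrr.
Qed.

Lemma cup22_coboundary (f g : cocycle A 2) :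
  (ccurry (cocycle_fun f) : A -> A -> A) w x = 0 -> is_coboundary (cochain_cup f g).
Proof.
move=> f0; have cF : @is_cocycle k A 4 (cochain_cup f g) := cup_cocycle f g.
apply: (cocycle4_coboundary HA cF).
apply/funext => c; apply/funext => d.
rewrite /= /cochain_cup (consv_lshift w) (consv_lshift x).
set v := (fun i : 'I_0 => _).
have -> : cocycle_fun f (consv w (consv x v)) = 0.
  by rewrite -[RHS]f0 /=; congr (cocycle_fun f (consv w (consv x _))); apply/funext => -[].
by rewrite mul0r mulr0.
Qed.

Lemma hcup_eq0 m n (u : HH A m.+1) (v : HH A n.+1) : hcup u v = 0.
Proof.
have [f ->] := hclass_surj u; have [g ->] := hclass_surj v.
have cob0 p (h : cocycle A p) : is_coboundary (cocycle_fun h) -> hclass h = 0.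
  move=> bh; have -> : (0 : HH A p) = hclass 0 by apply/esym/lquot_pi0.
  by apply/hclassP; rewrite subr0.
have high : (4 < m.+1 + n.+1)%N -> hcup (hclass f) (hclass g) = 0.
  move=> lt4; rewrite hcup_class; apply: cob0.
  by apply: (cocycle5_coboundary HA lt4); apply: cup_cocycle.
(* Below total degree 5: in bidegrees (1,2) and (2,1) the product is a 3-cocycle, in (1,3) and (3,1)
   a factor is; only (1,1) and (2,2) need normal forms. *)
case: m n u v f g high => [|[|[|m]]] [|[|[|n]]] u v f g high;
  do ?[by apply: high; rewrite // !addSn !addnS].
- have [f' <- nf] := normal1_exists f; have [g' <- ng] := normal1_exists g.
  by rewrite hcup_class; apply: cob0; apply: cup11_coboundary.
- rewrite hcup_class; apply: cob0; exact: cocycle3_coboundary HA _ (cup_cocycle f g).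
- rewrite hcup_class; apply: cob0; apply: cup_coboundaryr; first exact: cocycleP.
  exact: cocycle3_coboundary HA _ (cocycleP g).
- rewrite hcup_class; apply: cob0; exact: cocycle3_coboundary HA _ (cup_cocycle f g).
- have [f' <- f'0] := normal2_exists f.
  by rewrite hcup_class; apply: cob0; apply: cup22_coboundary.
- rewrite hcup_class; apply: cob0; apply: cup_coboundaryl; last exact: cocycleP.
  exact: cocycle3_coboundary HA _ (cocycleP f).
Qed.

End CupProducts.

(** * Associativity, unit and bilinearity of the cup product on classes *)

Section CohomologyAlgebra.
Variables (k : fieldType) (A : algType k).

Let HHA (n : nat) : lmodType k := HH A n.

Lemma gcastZ m n (e : m = n) c (u : HHA m) : gcast e (c *: u) = c *: gcast e u.
Proof. by case: n / e. Qed.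

Lemma gcast0 m n (e : m = n) : gcast e (0 : HHA m) = 0.
Proof. by case: n / e. Qed.

Lemma gcast_eq m n (e e' : m = n) (u : HHA m) : gcast e u = gcast e' u.
Proof. by rewrite (eq_irrelevance e e'). Qed.

Lemma gcast_comp m n p (e : m = n) (e' : n = p) (u : HHA m) :
  gcast e' (gcast e u) = gcast (etrans e e') u.
Proof. by case: p / e'; case: n / e. Qed.

(** Transport along an equality of degrees is reindexing of the cocycle, which reduces identities of
    classes to identities of cochains. *)
Lemma gcast_hclass m n (e : m = n) (f : cocycle A m) (g : cocycle A n) :
  (forall a, cocycle_fun g a = cocycle_fun f (fun i => a (cast_ord e i))) ->
  gcast e (hclass f : HHA m) = hclass g.
Proof.
case: n / e g => g E; rewrite /gcast /=; congr hclass; apply: val_inj.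
apply/funext => a; rewrite [RHS]E; congr (cocycle_fun f _).
by apply/funext => i; rewrite cast_ord_id.
Qed.

Lemma hclassD n c (f g : cocycle A n) :
  hclass (c *: f + g) = c *: hclass f + hclass g.
Proof. by rewrite /hclass lquot_piD lquot_piZ. Qed.

Lemma hcup_linearl m n (v : HHA n) : linear (fun u : HHA m => hcup u v : HHA (m + n)).
Proof.
have [g ->] := hclass_surj v; move=> c u u'.
have [f ->] := hclass_surj u; have [f' ->] := hclass_surj u'.
rewrite -hclassD !hcup_class -hclassD; congr hclass; apply: val_inj.
exact: cochain_cup_combl.
Qed.

Lemma hcup_linearr m n (u : HHA m) : linear (fun v : HHA n => hcup u v : HHA (m + n)).
Proof.
have [f ->] := hclass_surj u; move=> c v v'.
have [g ->] := hclass_surj v; have [g' ->] := hclass_surj v'.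
rewrite -hclassD !hcup_class -hclassD; congr hclass; apply: val_inj.
exact: cochain_cup_combr.
Qed.

Lemma sign_scale p (a : A) : (-1) ^+ p * a = ((-1) ^+ p : k) *: a.
Proof.
rewrite -signr_odd -[X in _ = X *: _]signr_odd; case: (odd p).
  by rewrite mulN1r scaleN1r.
by rewrite mul1r scale1r.
Qed.

Lemma hcupA m n p (u : HHA m) (v : HHA n) (t : HHA p) :
  gcast (addnA m n p) (hcup u (hcup v t) : HHA _) = hcup (hcup u v) t.
Proof.
have [f ->] := hclass_surj u; have [g ->] := hclass_surj v.
have [h ->] := hclass_surj t; rewrite !hcup_class.
apply: gcast_hclass => a; rewrite /= /cochain_cup !sign_scale.
rewrite -scalerAl -scalerAr !scalerA -!exprD mulnDl mulnDr -!mulrA.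
have a_eq (i j : 'I_(m + n + p)) : i = j :> nat -> a i = a j.
  by move=> /val_inj ->.
(* The signs agree because m (n + p) + n p = m n + (m + n) p. *)
congr ((-1) ^+ _ *: (cocycle_fun f _ * (cocycle_fun g _ * cocycle_fun h _))).
- by rewrite addnC addnA.
- by apply/funext => i; apply: a_eq.
- by apply/funext => i; apply: a_eq.
- by apply/funext => i; apply: a_eq; rewrite /= addnA.
Qed.

Lemma hcup1l n (u : HHA n) : gcast (add0n n) (hcup (hunit A) u : HHA _) = u.
Proof.
have [f ->] := hclass_surj u; rewrite /hunit hcup_class.
apply: gcast_hclass => a; rewrite /= /cochain_cup mul1r mul0n mul1r.
by congr (cocycle_fun f _); apply/funext => i; congr a; apply: val_inj.
Qed.

Lemma hcup1r n (u : HHA n) : gcast (addn0 n) (hcup u (hunit A) : HHA _) = u.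
Proof.
have [f ->] := hclass_surj u; rewrite /hunit hcup_class.
apply: gcast_hclass => a; rewrite /= /cochain_cup mulr1 muln0 mul1r.
by congr (cocycle_fun f _); apply/funext => i; congr a; apply: val_inj.
Qed.

Lemma linear_scale (U V : lmodType k) (f : U -> V) c u :
  linear f -> f (c *: u) = c *: f u.
Proof.
move=> lf; have f0 : f 0 = 0.
  by have := lf (-1) 0 0; rewrite scaler0 addr0 scaleN1r addNr.
by rewrite -[c *: u]addr0 lf f0 addr0.
Qed.

Lemma hcup_scall c n (v : HHA n) :
  gcast (add0n n) (hcup (c *: hunit A) v : HHA _) = c *: v.
Proof. by rewrite (linear_scale _ _ (hcup_linearl (m := 0) v)) gcastZ hcup1l. Qed.

Lemma hcup_scalr c n (v : HHA n) :
  gcast (addn0 n) (hcup v (c *: hunit A) : HHA _) = c *: v.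
Proof. by rewrite (linear_scale _ _ (hcup_linearr (n := 0) v)) gcastZ hcup1r. Qed.

Lemma hcup_scalC c n (v : HHA n) :
  (hcup (c *: hunit A) v : HHA (0 + n)) =
  gcast (addnC n 0) (hcup v (c *: hunit A) : HHA _).
Proof.
rewrite (gcast_eq _ (addn0 n)) hcup_scalr -[RHS](hcup_scall c v).
by rewrite (gcast_eq (add0n n) (erefl (0 + n)%N)).
Qed.

End CohomologyAlgebra.

(** * The cohomology algebra of A: scalars in degree 0, zero products in positive degrees *)

Theorem proposition4p1 (k : fieldType) (char_k : [pchar k] =i pred0) :
  let A : algType k := algA k in
  let HHA (n : nat) : lmodType k := HH A n in
  [/\ @graded_commutative_algebra k HHA (hunit A) (@hcup k A),
      forall u : HHA 0%N, exists! c : k, u = c *: hunit A,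
      forall (c : k) (n : nat) (v : HHA n),
        @gcast k HHA _ _ (add0n n) (hcup (c *: hunit A) v) = c *: v,
      forall (c : k) (n : nat) (v : HHA n),
        @gcast k HHA _ _ (addn0 n) (hcup v (c *: hunit A)) = c *: v
    & forall (m n : nat) (u : HHA m) (v : HHA n),
        (1 <= m)%N -> (1 <= n)%N -> hcup u v = 0].
Proof.
move=> A HHA; have HA := algA_presented k.
have cup0 m n (u : HHA m) (v : HHA n) : (0 < m)%N -> (0 < n)%N -> hcup u v = 0.
  case: m n u v => [|m] [|n] u v // _ _; exact: hcup_eq0 HA _ _ _ _.
(* A 0-cocycle is a central element of A. *)
have scalar (u : HHA 0) : exists c : k, u = c *: hunit A.
  have [f ->] := hclass_surj u; have [_ df] := is_cocycle_ccurry (cocycleP f).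
  pose c : A := ccurry (cocycle_fun f).
  have comm a : a * c = c * a.
    by have /eqP := congr1 (fun h : A -> A => h a) df; rewrite subr_eq0 => /eqP.
  have [l cE] := center_scalar HA (comm (genw k)) (comm (genx k)).
  exists l; rewrite /hunit -[_ *: _]addr0.
  have -> : (0 : HHA 0) = hclass 0 by apply/esym/lquot_pi0.
  rewrite -hclassD addr0; congr hclass; apply: val_inj; apply/funext => a.
  change (cocycle_fun f a = l%:A); rewrite -cE /c; congr (cocycle_fun f _).
  by apply/funext => -[].
split=> //.
- split.
  + by move=> m n v; apply: hcup_linearl.
  + by move=> m n u; apply: hcup_linearr.
  + exact: hcupA.
  + exact: hcup1l.
  + exact: hcup1r.
  (* In positive degrees both products vanish; otherwise a factor is a scalar and the sign is
     trivial. *)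
  + move=> [|m] [|n] u v; last first.
    * by rewrite !cup0 // gcast0 scaler0.
    * have [c ->] := scalar v; rewrite muln0 expr0 scale1r hcup_scalC.
      by rewrite gcast_comp (gcast_eq _ (erefl _)).
    * have [c ->] := scalar u; rewrite mul0n expr0 scale1r; exact: hcup_scalC.
    * have [c ->] := scalar u; rewrite mul0n expr0 scale1r; exact: hcup_scalC.
- move=> u; have [c E] := scalar u; exists c; split=> // c' E'.
  have : hclass (c *: mk_cocycle (hunit_cocycle A)) =
      hclass (c' *: mk_cocycle (hunit_cocycle A)).
    have hZ (d : k) : hclass (d *: mk_cocycle (hunit_cocycle A)) = d *: hunit A.
      exact: lquot_piZ.
    by rewrite !hZ -E -E'.
  (* The only coboundary in degree 0 is zero, so the scalars can be compared in A. *)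
  move=> /hclassP /(congr1 (fun h => h (fun _ => 0))).
  change (c *: (1 : A) - c' *: 1 = 0 -> c = c'); rewrite -scalerBl => /eqP.
  by rewrite scaler_eq0 oner_eq0 orbF subr_eq0 => /eqP.
- exact: hcup_scall.
- exact: hcup_scalr.
Qed.
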